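(* Let $A$ be a symmetric $n\times n$ integer matrix with all diagonal entries even, and let $q=q_A$ be its associated quadratic form. Then: (a) For any normal form $N(r,s,t,p,m)$ of $A$ one has $m=\dim(\overline V_{000})$, $p\equiv \dim(\overline V_0/\overline V_{000}) \pmod 2$, and, if $q(\overline V_0)=\{0\}$, $r\equiv \mathrm{Arf}(q)\pmod 2$. (b) For fixed $n$ and fixed $\dim(\overline V_{000})$, the parameters $p,r,s,t,m$ of the normal forms are determined by the isomorphism class of $q$ up to the congruences in (a); in particular, for the minimal non-negative values of $p$ and $r$ the normal form is unique. Explicitly: if $q(\overline V_0)=\{0\}$, then $A$ has exactly one normal form with $r\in\{0,1\}$ (and this normal form is determined by $n$, $\dim\overline V_{000}$ and the isomorphism class of $q$); if $q(\overline V_0)=\mathbb F_2$, then $A$ has exactly one normal form with $p\in\{1,2\}$ and $r=0$ (likewise determined by $n$, $\dim\overline V_{000}$ and the isomorphism class of $q$).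
   Context: Let $V=\mathbb Z^n$, $\overline V=\mathbb Z^n/2\mathbb Z^n$ (an $\mathbb F_2$-vector space), and $(v,w)=v^TAw$ for $v,w\in V$. Since the diagonal of $A$ is even, $(v,v)$ is even for all $v$; the quadratic form $q=q_A:\overline V\to\mathbb F_2$ is $q(v)=(v,v)/2 \bmod 2$ (depending only on the coset of $v$), and it satisfies $q(u+v)=q(u)+q(v)+\Omega(u,v)$ where $\Omega(v,w)=(v,w)\bmod 2$ is alternating bilinear. Define $V_0=\{v\in V:(v,w)\equiv 0 \pmod 2\ \forall w\in V\}$, $V_{00}=\{v\in V_0:(v,v)\equiv 0\pmod 4\}$, $V_{000}=\{v\in V_0:(v,w)\equiv 0\pmod 4\ \forall w\in V\}$, and the $\mathbb F_2$-spaces $\overline V_0=V_0/2V$, $\overline V_{00}=V_{00}/2V$, $\overline V_{000}=(V_{000}+2V)/2V$; $\overline V_0$ is the kernel of $\Omega$. Arf invariant: choose a basis $e_1,f_1,\dots,e_k,f_k,h_1,\dots,h_l$ of $\overline V$ with $\Omega(e_i,f_j)=\delta_{ij}$ and all other values of $\Omega$ on pairs of basis vectors equal to $0$; if $q(\overline V_0)=\{0\}$, $\mathrm{Arf}(q)=\sum_i q(e_i)q(f_i)\in\mathbb F_2$ (independent of the choice). Quadratic forms $q,q'$ on $\overline V$ are isomorphic if there is a linear isomorphism $T$ with $q(T(x))=q'(x)$ for all $x$. A normal form of $A$ is a matrix $N(r,s,t,p,m)=\mathrm{diag}\big(r\begin{pmatrix}2&1\\1&2\end{pmatrix}, s\begin{pmatrix}0&1\\1&0\end{pmatrix},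 t\begin{pmatrix}0&2\\2&0\end{pmatrix}, p(2), m(0)\big)$ (block diagonal with $r$, $s$, $t$, $p$, $m$ copies of the indicated blocks) such that $P^TAP\pmod 4 = N(r,s,t,p,m)$ for some integer matrix $P$ with $\det P=\pm1$; here $\pmod 4$ means entrywise reduction into $\{0,1,2,3\}$. *)

(* Defs.v *)
From HB Require Import structures.
From mathcomp Require Import all_boot all_order all_algebra.
From mathcomp Require Import boolp classical_sets ring.

Set Implicit Arguments.
Unset Strict Implicit.
Unset Printing Implicit Defensive.

Import GRing.Theory.
Local Open Scope ring_scope.

(* Z^n / 2 Z^n is represented as F_2^n: [red] is the projection, and [liftZ]
   the section with coordinates in {0, 1}. *)
Notation Vbar n := ('cV['F_2]_n).

Definition red n (v : 'cV[int]_n) : Vbar n := map_mx intr v.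

Definition liftZ n (x : Vbar n) : 'cV[int]_n :=
  map_mx (fun a : 'F_2 => (nat_of_ord a)%:Z) x.

Definition bform n (A : 'M[int]_n) (v w : 'cV[int]_n) : int :=
  (v^T *m A *m w) 0 0.

(* Independence of the representatives: [qform_red] and [Omega_red] below. *)
Definition qform n (A : 'M[int]_n) (x : Vbar n) : 'F_2 :=
  ((bform A (liftZ x) (liftZ x) %/ 2)%Z)%:~R.

Definition Omega n (A : 'M[int]_n) (x y : Vbar n) : 'F_2 :=
  (bform A (liftZ x) (liftZ y))%:~R.

Definition V0 n (A : 'M[int]_n) (v : 'cV[int]_n) : Prop :=
  forall w, (2 %| bform A v w)%Z.

Definition V000 n (A : 'M[int]_n) (v : 'cV[int]_n) : Prop :=
  V0 A v /\ forall w, (4 %| bform A v w)%Z.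

(* For a subgroup S of Z^n, this is (S + 2 Z^n) / 2 Z^n; the span adds nothing
   to the image of S, see [mem_Vbar0] and [mem_Vbar000]. *)
Definition redspace n (S : 'cV[int]_n -> Prop) : {vspace Vbar n} :=
  <<[seq x <- enum 'cV['F_2]_n | `[< exists2 v, S v & red v = x >]]>>%VS.

Definition Vbar0 n (A : 'M[int]_n) : {vspace Vbar n} := redspace (V0 A).
Definition Vbar000 n (A : 'M[int]_n) : {vspace Vbar n} := redspace (V000 A).

(* The set of values q(Vbar_0). *)
Definition qVbar0 n (A : 'M[int]_n) : {set 'F_2} :=
  [set qform A x | x in Vbar0 A].

Definition symplectic_basis n (A : 'M[int]_n) k l
    (e f : k.-tuple (Vbar n)) (h : l.-tuple (Vbar n)) : Prop :=
  [/\ basis_of fullv (e ++ f ++ h),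
      forall i j, Omega A (tnth e i) (tnth f j) = (i == j)%:R
                  /\ Omega A (tnth f j) (tnth e i) = (i == j)%:R,
      forall i j, Omega A (tnth e i) (tnth e j) = 0
                  /\ Omega A (tnth f i) (tnth f j) = 0,
      forall i j, [/\ Omega A (tnth e i) (tnth h j) = 0,
                      Omega A (tnth h j) (tnth e i) = 0,
                      Omega A (tnth f i) (tnth h j) = 0 &
                      Omega A (tnth h j) (tnth f i) = 0]
    & forall i j, Omega A (tnth h i) (tnth h j) = 0].

(* Meaningful only when q vanishes on Vbar_0: the value does then not depend
   on the symplectic basis. *)
Definition Arf n (A : 'M[int]_n) : 'F_2 :=
  xget 0 (fun a => exists k l (e f : k.-tuple (Vbar n)) (h : l.-tuple (Vbar n)),
    symplectic_basis A e f h
    /\ a = \sum_(i < k) qform A (tnth e i) * qform A (tnth f i)).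

Definition qf_iso n (q q' : Vbar n -> 'F_2) : Prop :=
  exists2 T : {linear Vbar n -> Vbar n},
    bijective T & forall x, q (T x) = q' x.

Record nfparams := NFParams { nf_r : nat; nf_s : nat; nf_t : nat;
                              nf_p : nat; nf_m : nat }.

Definition mx2 (a b c d : int) : 'M[int]_2 :=
  \matrix_(i, j) (if i == 0 then if j == 0 then a else b
                  else if j == 0 then c else d).

Definition copies (k : nat) (B : 'M[int]_2) : 'M[int]_(\sum_(i < k) 2) :=
  \mxdiag_(i < k) B.

Definition nf_dim (d : nfparams) : nat :=
  (\sum_(i < nf_r d) 2 + (\sum_(i < nf_s d) 2 +
    (\sum_(i < nf_t d) 2 + (nf_p d + nf_m d))))%N.

Definition nf_mx (d : nfparams) : 'M[int]_(nf_dim d) :=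
  block_mx (copies (nf_r d) (mx2 2 1 1 2)) 0 0 (
  block_mx (copies (nf_s d) (mx2 0 1 1 0)) 0 0 (
  block_mx (copies (nf_t d) (mx2 0 2 2 0)) 0 0 (
  block_mx (2%:M : 'M_(nf_p d)) 0 0 (0 : 'M_(nf_m d))))).

Definition normal_form n (A : 'M[int]_n) (d : nfparams) : Prop :=
  exists (en : n = nf_dim d) (P : 'M[int]_n),
    (\det P = 1 \/ \det P = -1) /\
    castmx (en, en) (map_mx (fun a => (a %% 4)%Z) (P^T *m A *m P)) = nf_mx d.

Section Facts.
Variables (n : nat) (A : 'M[int]_n).
Implicit Types (v w : 'cV[int]_n) (x y : Vbar n).

Lemma bformDl v v' w : bform A (v + v') w = bform A v w + bform A v' w.
Proof. by rewrite /bform linearD /= !mulmxDl mxE. Qed.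

Lemma bformDr v w w' : bform A v (w + w') = bform A v w + bform A v w'.
Proof. by rewrite /bform mulmxDr mxE. Qed.

Lemma bformZl a v w : bform A (a *: v) w = a * bform A v w.
Proof. by rewrite /bform linearZ /= -!scalemxAl mxE. Qed.

Lemma bformZr a v w : bform A v (a *: w) = a * bform A v w.
Proof. by rewrite /bform -scalemxAr mxE. Qed.

Lemma bformC v w : A^T = A -> bform A v w = bform A w v.
Proof.
move=> sA; rewrite /bform -[in LHS](trmxK (v^T *m A *m w)) mxE.
by rewrite !trmx_mul trmxK sA mulmxA.
Qed.

Lemma intrF2_eq0 (a : int) : ((a%:~R : 'F_2) == 0) = (2 %| a)%Z.
Proof.
case: a => k.
  rewrite dvdzE /= -pmulrn -(dvdn_pcharf (pchar_Fp (isT : prime 2))).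
  by [].
rewrite NegzE rmorphN /= oppr_eq0 dvdzE /= -pmulrn.
by rewrite -(dvdn_pcharf (pchar_Fp (isT : prime 2))).
Qed.

Lemma red_liftZ x : red (liftZ x) = x.
Proof.
by apply/matrixP=> i j; rewrite !mxE -pmulrn -[RHS](natr_Zp (x i j)).
Qed.

Lemma liftZ_red v : exists u, v = liftZ (red v) + 2 *: u.
Proof.
have dv i : (2 %| (v i 0 - liftZ (red v) i 0)%R)%Z.
  rewrite -intrF2_eq0 rmorphB /= subr_eq0.
  by have /matrixP/(_ i 0) := red_liftZ (red v); rewrite !mxE => ->.
exists (\col_i ((v i 0 - liftZ (red v) i 0)%R %/ 2)%Z).
apply/matrixP=> i j; rewrite ord1 [RHS]mxE [X in _ + X]mxE [X in 2 * X]mxE.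
by rewrite mulrC divzK // addrC subrK.
Qed.

Lemma Omega_red v w : Omega A (red v) (red w) = (bform A v w)%:~R.
Proof.
have [u vE] := liftZ_red v; have [u' wE] := liftZ_red w.
rewrite [in RHS]vE [in RHS]wE /Omega; move: (liftZ _) (liftZ _) => a b.
apply/eqP; rewrite -subr_eq0 -rmorphB intrF2_eq0.
rewrite !(bformDl, bformDr, bformZl, bformZr) -addrA opprD addrA subrr.
by rewrite sub0r rpredN !rpredD ?dvdz_mulr.
Qed.

Lemma qform_red v : A^T = A ->
  qform A (red v) = ((bform A v v %/ 2)%Z)%:~R.
Proof.
move=> sA; have [u vE] := liftZ_red v.
rewrite [in RHS]vE !(bformDl, bformDr, bformZl, bformZr).
rewrite (bformC u _ sA) /qform; set a := bform _ _ _; set b := bform _ _ _.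
set c := bform _ _ _.
have -> : a + 2 * b + (2 * b + 2 * (2 * c)) = (2 * b + 2 * c) * 2 + a.
  by ring.
apply/eqP; rewrite eq_sym divzMDl // -subr_eq0 -rmorphB /= intrF2_eq0 addrK.
by rewrite -mulrDr dvdz_mulr.
Qed.

Lemma mem_redspace (S : 'cV[int]_n -> Prop) x :
  S 0 -> (forall v w, S v -> S w -> S (v + w)) ->
  x \in redspace S <-> exists2 v, S v & red v = x.
Proof.
move=> S0 SD; split; last first.
  by move=> Sx; apply: memv_span; rewrite mem_filter mem_enum andbT; apply/asboolP.
rewrite /redspace; set X := [seq _ <- _ | _]; move=> /(@coord_span _ _ _ (in_tuple X)) ->.
apply: (big_ind (fun y => exists2 v, S v & red v = y)) => [|y z [v Sv <-] [w Sw <-]|i _].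
- by exists 0 => //; rewrite /red map_mx0.
- by exists (v + w); [exact: SD | rewrite /red map_mxD].
have : X`_i \in X by rewrite mem_nth.
rewrite mem_filter => /andP[/asboolP Sx _].
case: (coord _ _ _) => [[|[|//]] a_lt].
  exists 0 => //; rewrite /red map_mx0.
  by rewrite (_ : Ordinal a_lt = 0) ?scale0r //; apply: val_inj.
by rewrite (_ : Ordinal a_lt = 1) ?scale1r //; apply: val_inj.
Qed.

Lemma mem_Vbar0 x : x \in Vbar0 A <-> exists2 v, V0 A v & red v = x.
Proof.
apply: mem_redspace => [w|v v' h h' w].
  by rewrite -(scale0r 0) bformZl mul0r dvdz0.
by rewrite bformDl rpredD ?h ?h'.
Qed.

Lemma mem_Vbar000 x : x \in Vbar000 A <-> exists2 v, V000 A v & red v = x.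
Proof.
apply: mem_redspace => [|v v' [h k] [h' k']]; split=> w.
- by rewrite -(scale0r 0) bformZl mul0r dvdz0.
- by rewrite -(scale0r 0) bformZl mul0r dvdz0.
- by rewrite bformDl rpredD ?h ?h'.
by rewrite bformDl rpredD ?k ?k'.
Qed.

Lemma sub_Vbar000 : (Vbar000 A <= Vbar0 A)%VS.
Proof.
apply/subvP=> x /mem_Vbar000[v [v0 _] vx].
by apply/mem_Vbar0; exists v.
Qed.

End Facts.

(* Main.v *)
Require Import Defs.
From Corelib Require Import Setoid Morphisms.
From mathcomp Require Import all_boot all_order all_algebra.
From mathcomp Require Import fingroup perm finfield.
From mathcomp Require Import boolp classical_sets ring zify.

Set Implicit Arguments.
Unset Strict Implicit.
Unset Printing Implicit Defensive.

Import Order.TTheory GRing.Theory Num.Theory.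
Local Open Scope ring_scope.

(* Existence: integral congruence splits off, modulo 4, a 2 x 2 block with odd
   off-diagonal entry as long as some entry is odd, then a block (2) or
   [[0,2],[2,0]] as long as some entry is not divisible by 4. Writing E, H, K, D
   for the blocks [[2,1],[1,2]], [[0,1],[1,0]], [[0,2],[2,0]], (2), the
   relations E + E = H + H, E + D = H + D and D + D + D = D + K bring every
   normal form to a reduced one (p = 0 and r <= 1, or p = 1, 2 and r = 0).

   Uniqueness: the cardinals of Vbar_0 and Vbar_000, the Gauss sum of (-1)^q and
   the truth value of q(Vbar_0) = 0 are invariant under congruence modulo 4 and
   multiplicative for orthogonal sums, so they are read off the blocks. They
   determine the reduced normal form; all but #|Vbar_000| depend on q only. When
   q(Vbar_0) = 0 the Gauss sum computed in any symplectic basis is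
   2^(k+l) (-1)^Arf(q), and its sign for N(r,s,t,0,m) is (-1)^r. *)

(** * Even symmetric matrices and their bilinear forms *)

Definition even_sym n (A : 'M[int]_n) : Prop :=
  A^T = A /\ forall i, (2 %| A i i)%Z.

Lemma bformE n (A : 'M[int]_n) v w :
  bform A v w = \sum_i \sum_j v i 0 * A i j * w j 0.
Proof.
rewrite /bform mxE exchange_big; apply: eq_bigr => j _ /=.
by rewrite mxE big_distrl; apply: eq_bigr => i _; rewrite !mxE.
Qed.

(** Induction on the size, splitting off a 1 x 1 corner: the two off-diagonal terms are transposes
    of one another, so together they contribute an even number. *)
Lemma bform_even n (A : 'M[int]_n) v : even_sym A -> (2 %| bform A v v)%Z.
Proof.
elim: n => [|n IHn] in A v * => -[sA eA].
  by rewrite bformE big_ord0 dvdz0.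
rewrite -[v](@vsubmxK _ 1 n) -[A](@submxK _ 1 n 1 n).
rewrite /bform (@tr_col_mx _ 1 n) (@mul_row_block _ 1 1 n 1 n) (@mul_row_col _ 1 1 n).
set u := @usubmx _ 1 n 1 v; set w := @dsubmx _ 1 n 1 v.
set B := @ursubmx _ 1 n 1 n A; set D := @drsubmx _ 1 n 1 n A.
have -> : @dlsubmx _ 1 n 1 n A = B^T by rewrite /B trmx_ursub sA.
have eD : even_sym D.
  by split=> [|i]; [rewrite /D trmx_drsub sA | rewrite !mxE eA].
rewrite 2!mulmxDl mxE [X in (X + _)%R]mxE [X in (_ + X)%R]mxE.
have -> : (w^T *m B^T *m u) 0 0 = (u^T *m B *m w) 0 0.
  by rewrite -[in RHS](trmxK (u^T *m B *m w)) [RHS]mxE !trmx_mul trmxK mulmxA.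
have e1 : (2 %| (u^T *m (@ulsubmx _ 1 n 1 n A) *m u)%R 0%R 0%R)%Z.
  rewrite mxE big_ord1 mxE big_ord1 !mxE; apply: dvdz_mulr; apply: dvdz_mull.
  exact: eA.
have := IHn D w eD; rewrite /bform; move: e1.
set x := (_ *m u) 0 0; set y := (_ *m w) 0 0; set z := (_ *m w) 0 0.
lia.
Qed.

Lemma bform_conj n m (A : 'M[int]_n) (P : 'M_(n, m)) v w :
  bform (P^T *m A *m P) v w = bform A (P *m v) (P *m w).
Proof. by rewrite /bform trmx_mul !mulmxA. Qed.

Lemma bform_delta n (A : 'M[int]_n) i j :
  bform A (delta_mx i 0) (delta_mx j 0) = A i j.
Proof. by rewrite /bform trmx_delta -rowE -colE !mxE. Qed.

Lemma even_sym_conj n m (A : 'M[int]_n) (P : 'M_(n, m)) :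
  even_sym A -> even_sym (P^T *m A *m P).
Proof.
move=> eA; split; first by rewrite !trmx_mul trmxK eA.1 mulmxA.
by move=> i; rewrite -bform_delta bform_conj bform_even.
Qed.

Lemma even_sym_block n m (A : 'M[int]_n) (B : 'M_m) :
  even_sym A -> even_sym B -> even_sym (block_mx A 0 0 B).
Proof.
move=> [sA eA] [sB eB]; split; first by rewrite tr_block_mx !trmx0 sA sB.
by move=> i; case: (split_ordP i) => j ->; rewrite ?block_mxEul ?block_mxEdr.
Qed.

(** * Even lattices, orthogonal sums and congruence modulo 4 *)

Record lat := Lat {
  rank_lat : nat;
  gram :> 'M[int]_rank_lat;
  gramP : even_sym gram }.

Lemma even_sym_osum (L M : lat) : even_sym (block_mx L 0 0 M).
Proof. by apply: even_sym_block; apply: gramP. Qed.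

Definition osum (L M : lat) : lat := Lat (even_sym_osum L M).

(** [P] is rectangular with a two-sided inverse, so lattices whose ranks are only provably equal are
    compared without casts. Equality of the ranks ([eqv_rank]) and determinant 1 or -1 are
    consequences. *)
Definition eqv (L M : lat) : Prop :=
  exists (P : 'M_(rank_lat L, rank_lat M)) (Q : 'M_(rank_lat M, rank_lat L)) E,
    [/\ P *m Q = 1%:M, Q *m P = 1%:M & P^T *m L *m P = gram M + 4 *: E].

Infix "≃" := eqv (at level 70).
Infix "⊕" := osum (at level 60, right associativity).

Lemma eqv_refl L : L ≃ L.
Proof.
by exists 1%:M, 1%:M, 0; rewrite trmx1 !mul1mx !mulmx1 scaler0 addr0.
Qed.

Lemma gram_inverse m n (A : 'M[int]_m) (B : 'M[int]_n) (P : 'M_(m, n)) Q E :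
  P *m Q = 1%:M -> P^T *m A *m P = B + 4 *: E ->
  Q^T *m B *m Q = A + 4 *: (- (Q^T *m E *m Q)).
Proof.
move=> PQ eE; have -> : B = P^T *m A *m P - 4 *: E by rewrite eE addrK.
rewrite mulmxBr mulmxBl !mulmxA -trmx_mul PQ trmx1 mul1mx -mulmxA PQ mulmx1.
by rewrite -scalemxAr -scalemxAl scalerN.
Qed.

Lemma eqv_sym L M : L ≃ M -> M ≃ L.
Proof.
move=> [P] [Q] [E] [PQ QP eE]; exists Q, P, (- (Q^T *m E *m Q)).
by split=> //; apply: gram_inverse eE.
Qed.

Lemma eqv_trans L M N : L ≃ M -> M ≃ N -> L ≃ N.
Proof.
move=> [P] [Q] [E] [PQ QP eE] [P'] [Q'] [E'] [PQ' QP' eE'].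
exists (P *m P'), (Q' *m Q), (E' + P'^T *m E *m P'); split.
- by rewrite mulmxA -(mulmxA P) PQ' mulmx1.
- by rewrite mulmxA -(mulmxA Q') QP mulmx1.
rewrite trmx_mul -!mulmxA (mulmxA L) (mulmxA P^T) (mulmxA P^T) eE.
by rewrite mulmxDl mulmxDr mulmxA eE' -scalemxAl -scalemxAr scalerDr addrA mulmxA.
Qed.

#[local] Hint Resolve eqv_refl : core.

#[local] Instance eqv_Equivalence : Equivalence eqv.
Proof. by split; [exact: eqv_refl | exact: eqv_sym | exact: eqv_trans]. Qed.

(** Together with the equivalence instance, this turns relations between blocks into rewriting rules
    for summands. *)
#[local] Instance osum_Proper : Proper (eqv ==> eqv ==> eqv) osum.
Proof.
move=> L M [P] [Q] [E] [PQ QP eE] L' M' [P'] [Q'] [E'] [PQ' QP' eE'].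
exists (block_mx P 0 0 P'), (block_mx Q 0 0 Q'), (block_mx E 0 0 E').
rewrite tr_block_mx !mulmx_block !trmx0 !(mulmx0, mul0mx, add0r, addr0).
rewrite PQ QP PQ' QP' eE eE' -!scalar_mx_block; split=> //=.
by rewrite scale_block_mx add_block_mx !scaler0 !addr0.
Qed.

Lemma osumC L M : L ⊕ M ≃ M ⊕ L.
Proof.
exists (block_mx 0 1%:M 1%:M 0), (block_mx 0 1%:M 1%:M 0), 0; split => /=.
- by rewrite mulmx_block !(mulmx0, mul0mx, add0r, addr0, mulmx1) -scalar_mx_block.
- by rewrite mulmx_block !(mulmx0, mul0mx, add0r, addr0, mulmx1) -scalar_mx_block.
rewrite tr_block_mx !trmx0 !trmx1 !mulmx_block scaler0.
by rewrite !(mulmx0, mul0mx, add0r, addr0, mulmx1, mul1mx).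
Qed.

Lemma eqv_cast (L M : lat) (e : rank_lat L = rank_lat M) :
  gram M = castmx (e, e) L -> L ≃ M.
Proof.
case: M e => m B Be /= e; case: m / e B Be => B Be; rewrite castmx_id => eB.
by exists 1%:M, 1%:M, 0; rewrite trmx1 !mul1mx !mulmx1 scaler0 addr0 /= eB.
Qed.

Lemma osumA L M N : L ⊕ (M ⊕ N) ≃ (L ⊕ M) ⊕ N.
Proof.
apply: eqv_sym.
refine (@eqv_cast ((L ⊕ M) ⊕ N) (L ⊕ (M ⊕ N))
  (esym (addnA (rank_lat L) (rank_lat M) (rank_lat N))) _) => /=.
by have := @block_mxAx _ _ _ _ _ _ _ L 0 0 0 M 0 0 0 N; rewrite /= !row_mx0 !col_mx0.
Qed.

Lemma osumCA L M N : L ⊕ (M ⊕ N) ≃ M ⊕ (L ⊕ N).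
Proof. by rewrite osumA (osumC L M) -osumA. Qed.

Lemma eqv_rank L M : L ≃ M -> rank_lat L = rank_lat M.
Proof.
move=> [P] [Q] [E] [/mulmx1_min PQ /mulmx1_min QP _].
by apply/eqP; rewrite eqn_leq PQ QP.
Qed.

Lemma eqv_gram (L M : lat) (e : rank_lat L = rank_lat M) :
  (forall i j, (4 %| L i j - M (cast_ord e i) (cast_ord e j))%Z) -> L ≃ M.
Proof.
case: M e => m B Be /= e; case: m / e B Be => B Be h.
exists 1%:M, 1%:M, (\matrix_(i, j) ((L i j - B i j) %/ 4)%Z).
split; rewrite ?trmx1 ?mul1mx ?mulmx1 //=; apply/matrixP => i j.
have := h i j; rewrite !cast_ord_id => hij.
by rewrite !mxE mulrC divzK // addrC subrK.
Qed.

Lemma eqv_conj (L : lat) (P Q : 'M_(rank_lat L)) :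
  P *m Q = 1%:M -> L ≃ Lat (even_sym_conj P (gramP L)).
Proof.
move=> PQ; exists P, Q, 0; split=> //; first exact: mulmx1C.
by rewrite scaler0 addr0.
Qed.

Lemma even_sym_dr a b (A : 'M[int]_(a + b)) : even_sym A -> even_sym (drsubmx A).
Proof.
by move=> [sA eA]; split=> [|i]; [rewrite trmx_drsub sA | rewrite !mxE eA].
Qed.

Lemma even_sym_ul a b (A : 'M[int]_(a + b)) : even_sym A -> even_sym (ulsubmx A).
Proof.
by move=> [sA eA]; split=> [|i]; [rewrite trmx_ulsub sA | rewrite !mxE eA].
Qed.

(** Completing the square modulo 4: for a corner [U] and off-diagonal block [B], the shear [P]
    replaces [B] by [B - U C], here a multiple of 4. The hypothesis asks that [U C = B] be solvable
    modulo 4, which also covers the corners (2), [[0,2],[2,0]] and (0), singular modulo 4. *)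
Lemma eqv_split a b (A : 'M[int]_(a + b)) (eA : even_sym A) (C F : 'M_(a, b)) :
  ulsubmx A *m C = ursubmx A + 4 *: F ->
  exists N : lat, rank_lat N = b /\ Lat eA ≃ Lat (even_sym_ul eA) ⊕ N.
Proof.
move=> eC.
pose P : 'M[int]_(a + b) := block_mx 1%:M (- C) 0 1%:M.
pose Q : 'M[int]_(a + b) := block_mx 1%:M C 0 1%:M.
have PQ : P *m Q = 1%:M.
  rewrite mulmx_block !(mulmx0, mul0mx, add0r, addr0, mulmx1, mul1mx) subrr.
  by rewrite -scalar_mx_block.
exists (Lat (even_sym_dr (even_sym_conj P eA))); split=> //.
have dlE : dlsubmx A = (ursubmx A)^T by rewrite trmx_ursub eA.1.
have sU : (ulsubmx A)^T = ulsubmx A by rewrite trmx_ulsub eA.1.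
exists P, Q, (block_mx 0 (- F) (- F^T) 0); split => //=.
  exact: mulmx1C.
set X := P^T *m A *m P; rewrite -[LHS]submxK scale_block_mx add_block_mx.
rewrite !scaler0 !addr0 !add0r.
have XE : X = block_mx (ulsubmx A) (- (4 *: F)) (- (4 *: F^T)) (drsubmx X).
  rewrite -[LHS]submxK {1 2 3}/X -[A in _ *m A *m _]submxK /P.
  rewrite tr_block_mx !mulmx_block !trmx1 !trmx0.
  rewrite !(mulmx0, mul0mx, add0r, addr0, mulmx1, mul1mx).
  rewrite block_mxKul block_mxKur block_mxKdl; congr block_mx.
    by rewrite mulmxN eC opprD addrC addrA subrr add0r.
  rewrite linearN /= mulNmx -{1}sU -trmx_mul eC dlE.
  by rewrite linearD linearZ /= opprD addrAC addNr add0r.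
by rewrite XE block_mxKul block_mxKur block_mxKdl block_mxKdr !scalerN.
Qed.

(** * The blocks of a normal form *)

Lemma mx2E (M : 'M[int]_2) : M = mx2 (M 0 0) (M 0 1) (M 1 0) (M 1 1).
Proof.
apply/matrixP=> i j; rewrite mxE.
by case: i => [[|[|//]] ?]; case: j => [[|[|//]] ?]; congr (M _ _); apply: val_inj.
Qed.

Lemma even_sym_mx2 a b c : even_sym (mx2 (2 * a) b b (2 * c)).
Proof.
split=> [|i]; last first.
  by rewrite mxE; case: (i == 0); apply: dvdz_mulr.
by apply/matrixP=> i j; rewrite !mxE; case: (i == 0); case: (j == 0).
Qed.

Lemma even_sym_cast m n (e : m = n) (A : 'M[int]_m) :
  even_sym A -> even_sym (castmx (e, e) A).
Proof. by case: n / e; rewrite castmx_id. Qed.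

Lemma copiesS k B :
  copies k.+1 B = castmx (mxsize_recl, mxsize_recl) (block_mx B 0 0 (copies k B)).
Proof. exact: mxdiag_recl. Qed.

Lemma even_sym_copies k B : even_sym B -> even_sym (copies k B).
Proof.
move=> eB; elim: k => [|k IHk]; last first.
  by rewrite copiesS; apply: even_sym_cast; apply: even_sym_block.
split; first by apply/matrixP=> i; have := ltn_ord i; rewrite {2}big_ord0.
by move=> i; have := ltn_ord i; rewrite {2}big_ord0.
Qed.

Lemma even_sym_scalar2 n : even_sym (2%:M : 'M_n).
Proof. by split=> [|i]; [rewrite tr_scalar_mx | rewrite mxE eqxx]. Qed.

Lemma even_sym0 n : even_sym (0 : 'M_n).
Proof. by split=> [|i]; [rewrite trmx0 | rewrite mxE dvdz0]. Qed.

Definition copies_lat k B (eB : even_sym B) := Lat (even_sym_copies k eB).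
Definition lE := Lat (even_sym_mx2 1 1 1).
Definition lH := Lat (even_sym_mx2 0 1 0).
Definition lK := Lat (even_sym_mx2 0 2 0).
Definition scalar2_lat n := Lat (even_sym_scalar2 n).
Definition zero_lat n := Lat (even_sym0 n).

(** Nested exactly as [nf_mx], so that its Gram matrix is [nf_mx d] by conversion, while the
    parameters can be changed by rewriting orthogonal sums. *)
Definition nf_lat (d : nfparams) : lat :=
  copies_lat (nf_r d) (gramP lE) ⊕ copies_lat (nf_s d) (gramP lH) ⊕
  copies_lat (nf_t d) (gramP lK) ⊕ scalar2_lat (nf_p d) ⊕ zero_lat (nf_m d).

Lemma gram_nf_lat d : gram (nf_lat d) = nf_mx d.
Proof. by []. Qed.

Lemma copies_latS k B (eB : even_sym B) :
  copies_lat k.+1 eB ≃ Lat eB ⊕ copies_lat k eB.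
Proof.
apply: eqv_sym.
apply: (@eqv_cast (Lat eB ⊕ copies_lat k eB) (copies_lat k.+1 eB) mxsize_recl).
exact: copiesS.
Qed.

Lemma scalar2_latS n : scalar2_lat n.+1 ≃ scalar2_lat 1 ⊕ scalar2_lat n.
Proof.
apply: (@eqv_cast (scalar2_lat n.+1) (scalar2_lat 1 ⊕ scalar2_lat n) erefl).
by rewrite castmx_id /= -scalar_mx_block.
Qed.

Lemma zero_latS n : zero_lat n.+1 ≃ zero_lat 1 ⊕ zero_lat n.
Proof.
apply: (@eqv_cast (zero_lat n.+1) (zero_lat 1 ⊕ zero_lat n) erefl).
by rewrite castmx_id; apply: block_mx0.
Qed.

Lemma nf_addE r s t p m :
  nf_lat (NFParams r.+1 s t p m) ≃ lE ⊕ nf_lat (NFParams r s t p m).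
Proof. by rewrite /nf_lat /= (copies_latS r) -osumA. Qed.

Lemma nf_addH r s t p m :
  nf_lat (NFParams r s.+1 t p m) ≃ lH ⊕ nf_lat (NFParams r s t p m).
Proof. by rewrite /nf_lat /= (copies_latS s) -osumA osumCA. Qed.

Lemma nf_addK r s t p m :
  nf_lat (NFParams r s t.+1 p m) ≃ lK ⊕ nf_lat (NFParams r s t p m).
Proof.
rewrite /nf_lat /= (copies_latS t) -osumA.
by do 2 rewrite (osumCA (copies_lat _ _) lK).
Qed.

Lemma nf_addD r s t p m :
  nf_lat (NFParams r s t p.+1 m) ≃ scalar2_lat 1 ⊕ nf_lat (NFParams r s t p m).
Proof.
rewrite /nf_lat /= (scalar2_latS p) -osumA.
by do 3 rewrite (osumCA (copies_lat _ _) (scalar2_lat 1)).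
Qed.

Lemma nf_addZ r s t p m :
  nf_lat (NFParams r s t p m.+1) ≃ zero_lat 1 ⊕ nf_lat (NFParams r s t p m).
Proof.
rewrite /nf_lat /= (zero_latS m) (osumCA (scalar2_lat _) (zero_lat 1)).
by do 3 rewrite (osumCA (copies_lat _ _) (zero_lat 1)).
Qed.

(** * Relations between the blocks, by explicit changes of basis *)

Definition seq_entry (l : seq (seq int)) i j : int := nth 0 (nth [::] l i) j.

(** Lists of rows allow products of explicit matrices, and congruences between them, to be settled
    by [vm_compute]. *)
Definition seqmx n l : 'M[int]_n := \matrix_(i, j) seq_entry l i j.

Definition mkseq2 n (f : nat -> nat -> int) :=
  mkseq (fun i => mkseq (f i) n) n.

Definition seqmul n l l' := mkseq2 n (fun i j =>
  foldr (fun k s => seq_entry l i k * seq_entry l' k j + s) 0 (iota 0 n)).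

Definition seqtr n l := mkseq2 n (fun i j => seq_entry l j i).

Lemma seq_entry_mkseq2 n f (i j : 'I_n) : seq_entry (mkseq2 n f) i j = f i j.
Proof. by rewrite /seq_entry !nth_mkseq. Qed.

Lemma seqmx_mul n l l' : seqmx n l *m seqmx n l' = seqmx n (seqmul n l l').
Proof.
apply/matrixP=> i j; rewrite !mxE seq_entry_mkseq2 /=.
under eq_bigr => k _ do rewrite !mxE.
pose F k := seq_entry l i k * seq_entry l' k j.
by rewrite -(big_mkord xpredT F) /index_iota subn0 unlock.
Qed.

Lemma seqmx_tr n l : (seqmx n l)^T = seqmx n (seqtr n l).
Proof. by apply/matrixP=> i j; rewrite !mxE seq_entry_mkseq2. Qed.

Lemma seqmx_id n : seqmx n (mkseq2 n (fun i j => (i == j)%:Z)) = 1%:M.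
Proof. by apply/matrixP=> i j; rewrite !mxE seq_entry_mkseq2 -val_eqE /=; case: eqP. Qed.

(** A certificate: [p] is the change of basis and [q] its inverse; the transform of [a] is compared
    with [b] entry by entry modulo 4. *)
Lemma eqv_seqmx n (L M : lat) (eL : rank_lat L = n) (eM : rank_lat M = n) a b p q :
  castmx (eL, eL) L = seqmx n a -> castmx (eM, eM) M = seqmx n b ->
  seqmul n p q = mkseq2 n (fun i j => (i == j)%:Z) ->
  all (fun i => all (fun j => 4 %|
    seq_entry (seqmul n (seqmul n (seqtr n p) a) p) i j - seq_entry b i j)%Z
    (iota 0 n)) (iota 0 n) ->
  L ≃ M.
Proof.
case: n / eL => /= in eM *; case: M eM => m B Be /= eM; subst m.
rewrite !castmx_id => La Bb /(congr1 (seqmx (rank_lat L))).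
rewrite -seqmx_mul seqmx_id => PQ /allP h; apply: eqv_trans (eqv_conj PQ) _.
refine (@eqv_gram (Lat (even_sym_conj (seqmx _ p) (gramP L))) (Lat Be) erefl _).
move=> i j; rewrite !cast_ord_id /= La Bb seqmx_tr !seqmx_mul !mxE.
have /h/allP : (i : nat) \in iota 0 (rank_lat L) by rewrite mem_iota ltn_ord.
by apply; rewrite mem_iota ltn_ord.
Qed.

Ltac block_entries :=
  rewrite castmx_id; apply/matrixP;
  move=> [[|[|[|[|//]]]] ?] [[|[|[|[|//]]]] ?];
  rewrite !mxE /=;
  repeat (case: splitP => // -[[|[|//]] ?] //= _; rewrite ?mxE //=).

(** The Arf invariant of E + E is 1 + 1 = 0, as for two hyperbolic planes. The columns of the change
    of basis have norms 4, 4, 8, 8, all 0 modulo 4. *)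
Lemma eqv_EE : lE ⊕ lE ≃ lH ⊕ lH.
Proof.
refine (@eqv_seqmx 4 (lE ⊕ lE) (lH ⊕ lH) erefl erefl
  [:: [:: 2; 1; 0; 0]; [:: 1; 2; 0; 0]; [:: 0; 0; 2; 1]; [:: 0; 0; 1; 2]]
  [:: [:: 0; 1; 0; 0]; [:: 1; 0; 0; 0]; [:: 0; 0; 0; 1]; [:: 0; 0; 1; 0]]
  [:: [:: 0; 0; 1; -1]; [:: 1; 1; 1; 2]; [:: 0; 1; 1; 1]; [:: 1; -1; 0; 0]]
  [:: [:: 1; 2; -3; -1]; [:: 1; 2; -3; -2]; [:: 0; -1; 2; 1]; [:: -1; -1; 2; 1]]
  _ _ _ _); [by block_entries | by block_entries | by vm_compute | by vm_compute].
Qed.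

(** Up to sign, the generator of D, of norm 2, is added to each basis vector of E: the norms become
    4 and the product stays odd. The third column (2, 2, 5) has norm 2 modulo 4 and is orthogonal to
    both modulo 4. *)
Lemma eqv_ED : lE ⊕ scalar2_lat 1 ≃ lH ⊕ scalar2_lat 1.
Proof.
refine (@eqv_seqmx 3 (lE ⊕ scalar2_lat 1) (lH ⊕ scalar2_lat 1) erefl erefl
  [:: [:: 2; 1; 0]; [:: 1; 2; 0]; [:: 0; 0; 2]]
  [:: [:: 0; 1; 0]; [:: 1; 0; 0]; [:: 0; 0; 2]]
  [:: [:: -1; 0; 2]; [:: 0; 1; 2]; [:: -1; 1; 5]]
  [:: [:: -3; -2; 2]; [:: 2; 3; -2]; [:: -1; -1; 1]]
  _ _ _ _); [by block_entries | by block_entries | by vm_compute | by vm_compute].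
Qed.

(** The vector (1, 1, 1) has norm 6 and is orthogonal modulo 4 to (1, 1, 0) and (0, 1, 1), which
    have norm 4 and product 2 and so span a copy of K. *)
Lemma eqv_DDD :
  scalar2_lat 1 ⊕ scalar2_lat 1 ⊕ scalar2_lat 1 ≃ scalar2_lat 1 ⊕ lK.
Proof.
refine (@eqv_seqmx 3 (scalar2_lat 1 ⊕ scalar2_lat 1 ⊕ scalar2_lat 1)
  (scalar2_lat 1 ⊕ lK) erefl erefl
  [:: [:: 2; 0; 0]; [:: 0; 2; 0]; [:: 0; 0; 2]]
  [:: [:: 2; 0; 0]; [:: 0; 0; 2]; [:: 0; 2; 0]]
  [:: [:: 1; 1; 0]; [:: 1; 1; 1]; [:: 1; 0; 1]]
  [:: [:: 1; -1; 1]; [:: 0; 1; -1]; [:: -1; 1; 0]]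
  _ _ _ _); [by block_entries | by block_entries | by vm_compute | by vm_compute].
Qed.

Lemma nf_reduceE r s t p m :
  nf_lat (NFParams r.+2 s t p m) ≃ nf_lat (NFParams r s.+2 t p m).
Proof. by rewrite !nf_addE !nf_addH !osumA eqv_EE. Qed.

Lemma nf_reduceED r s t p m :
  nf_lat (NFParams r.+1 s t p.+1 m) ≃ nf_lat (NFParams r s.+1 t p.+1 m).
Proof. by rewrite nf_addE nf_addH !nf_addD !osumA eqv_ED. Qed.

Lemma nf_reduceD r s t p m :
  nf_lat (NFParams r s t p.+3 m) ≃ nf_lat (NFParams r s t.+1 p.+1 m).
Proof.
rewrite !nf_addD nf_addK !osumA -(osumA _ (scalar2_lat 1) (scalar2_lat 1)).
by rewrite eqv_DDD.
Qed.

(** * Reduction of the parameters *)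

Definition reduced (d : nfparams) : bool :=
  [|| (nf_p d == 0%N) && (nf_r d <= 1)%N | (1 <= nf_p d <= 2)%N && (nf_r d == 0%N)].

(** While p is at least 3, two copies of D are traded for one K; then, for p = 1 or 2, every E
    becomes an H, and for p = 0 the copies of E disappear in pairs. *)
Lemma nf_reduced d : exists2 d', reduced d' & nf_lat d ≃ nf_lat d'.
Proof.
case: d => r s t p m; elim/ltn_ind: p t => p IHp t.
case: p => [|p] in IHp *.
  move=> {IHp}.
  elim/ltn_ind: r s => -[|[|r]] IHr s; try by eexists; last exact: eqv_refl.
  have [|d' red_d' h] := IHr r _ s.+2; first by [].
  by exists d' => //; rewrite nf_reduceE.
case: p => [|[|p]] in IHp *; first last.
- have [|d' red_d' h] := IHp p.+1 _ t.+1; first by [].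
  by exists d' => //; rewrite nf_reduceD.
- move=> {IHp}; elim: r s => [|r IHr] s; first by eexists; last exact: eqv_refl.
  by have [d' red_d' h] := IHr s.+1; exists d' => //; rewrite nf_reduceED.
- move=> {IHp}; elim: r s => [|r IHr] s; first by eexists; last exact: eqv_refl.
  by have [d' red_d' h] := IHr s.+1; exists d' => //; rewrite nf_reduceED.
Qed.

(** * Splitting blocks off a lattice *)

Lemma mx2M a b c d a' b' c' d' :
  mx2 a b c d *m mx2 a' b' c' d' =
  mx2 (a * a' + b * c') (a * b' + b * d') (c * a' + d * c') (c * b' + d * d').
Proof.
apply/matrixP=> i j; rewrite !mxE !big_ord_recl big_ord0 !mxE /= addr0.
by case: (i == 0); case: (j == 0).
Qed.

(** The three divisibilities compare with [u], [v], [w] the Gram entries of the new basis vectors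
    (p, r) and (q, s). *)
Lemma eqv_mx2 (a b c : int) (L T : lat) (eL : rank_lat L = 2) (eT : rank_lat T = 2)
    (u v w p q r s : int) :
  castmx (eL, eL) L = mx2 (2 * a) b b (2 * c) -> castmx (eT, eT) T = mx2 u v v w ->
  p * s - q * r = 1 \/ p * s - q * r = -1 ->
  (4 %| 2 * a * (p * p) + 2 * b * (p * r) + 2 * c * (r * r) - u)%Z ->
  (4 %| 2 * a * (p * q) + b * (p * s + q * r) + 2 * c * (r * s) - v)%Z ->
  (4 %| 2 * a * (q * q) + 2 * b * (q * s) + 2 * c * (s * s) - w)%Z -> L ≃ T.
Proof.
case: L eL => l A Ae /= eL; case: T eT => m B Be /= eT; subst l m.
rewrite !castmx_id => AE BE; set d := p * s - q * r => d1 hu hv hw.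
have dd : d * d = 1 by case: d1 => ->.
(* The determinant [d] is its own inverse, so the inverse of [P] is [d] times the adjugate. *)
pose P := mx2 p q r s; pose Q := mx2 (d * s) (- d * q) (- d * r) (d * p).
have PQ : P *m Q = 1%:M.
  rewrite mx2M [1%:M]mx2E !mxE /= -dd; congr mx2; rewrite /d; ring.
apply: eqv_trans (eqv_conj (L := Lat Ae) PQ) _.
refine (@eqv_gram (Lat (even_sym_conj P (gramP (Lat Ae)))) (Lat Be) erefl _).
have PT : P^T = mx2 p r q s by rewrite [LHS]mx2E !mxE.
move=> i j; rewrite !cast_ord_id /= PT AE BE !mx2M !mxE.
case: (i == 0); case: (j == 0); [move: hu | move: hv | move: hv | move: hw];
  by congr (_ %| _)%Z; congr (_ - _); ring.
Qed.

(** Modulo 4 the diagonal matters only through the parities of [a] and [c], and a sign change makes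
    the off-diagonal entry 1. If both are odd the block is E. If exactly one is odd, adding the
    other basis vector to the one of norm 2 makes its norm 0, and the block is H. *)
Lemma eqv_odd2 (L : lat) (eL : rank_lat L = 2) a b c :
  castmx (eL, eL) L = mx2 (2 * a) b b (2 * c) -> ~~ (2 %| b)%Z ->
  L ≃ lE \/ L ≃ lH.
Proof.
move=> Lm ob.
have [b1|b3] : (4 %| b - 1)%Z \/ (4 %| b + 1)%Z by lia.
- have [a0|a1] := boolP (2 %| a)%Z.
    right; have [c0|c1] := boolP (2 %| c)%Z.
      by apply: (@eqv_mx2 a b c _ lH eL erefl 0 1 0 1 0 0 1 Lm (castmx_id _ _)); lia.
    by apply: (@eqv_mx2 a b c _ lH eL erefl 0 1 0 1 1 0 1 Lm (castmx_id _ _)); lia.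
  have [c0|c1] := boolP (2 %| c)%Z.
    right.
    by apply: (@eqv_mx2 a b c _ lH eL erefl 0 1 0 1 0 1 1 Lm (castmx_id _ _)); lia.
  left.
  by apply: (@eqv_mx2 a b c _ lE eL erefl 2 1 2 1 0 0 1 Lm (castmx_id _ _)); lia.
have [a0|a1] := boolP (2 %| a)%Z.
  right; have [c0|c1] := boolP (2 %| c)%Z.
    by apply: (@eqv_mx2 a b c _ lH eL erefl 0 1 0 1 0 0 (-1) Lm (castmx_id _ _)); lia.
  by apply: (@eqv_mx2 a b c _ lH eL erefl 0 1 0 (-1) 1 0 1 Lm (castmx_id _ _)); lia.
have [c0|c1] := boolP (2 %| c)%Z.
  right.
  by apply: (@eqv_mx2 a b c _ lH eL erefl 0 1 0 1 0 1 (-1) Lm (castmx_id _ _)); lia.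
left.
by apply: (@eqv_mx2 a b c _ lE eL erefl 2 1 2 1 0 0 (-1) Lm (castmx_id _ _)); lia.
Qed.

Lemma eqv_perm n (A : 'M[int]_n) (eA : even_sym A) (s : 'S_n) :
  exists eB : even_sym (row_perm s (col_perm s A)), Lat eA ≃ Lat eB.
Proof.
have rE : row_perm s (col_perm s A) = (perm_mx s^-1)^T *m A *m perm_mx s^-1.
  by rewrite row_permE col_permE mulmxA tr_perm_mx invgK.
have eB : even_sym (row_perm s (col_perm s A)) by rewrite rE; apply: even_sym_conj.
exists eB.
have PQ : perm_mx s^-1 *m perm_mx s = 1%:M :> 'M[int]_n.
  by rewrite -perm_mxM mulVg perm_mx1.
apply: eqv_trans (eqv_conj (L := Lat eA) PQ) _.
refine (@eqv_cast (Lat (even_sym_conj (perm_mx s^-1) eA)) (Lat eB) erefl _).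
by rewrite castmx_id.
Qed.

(** [k] is the index that the transposition of 0 and [i] sends to [j]; exchanging 1 and [k]
    beforehand leaves 0 in place because [k] is not 0. *)
Lemma perm_front2 n (i j : 'I_n.+2) : i != j ->
  exists s : 'S_n.+2,
    s (Ordinal (isT : 0 < n.+2)%N) = i /\ s (Ordinal (isT : 1 < n.+2)%N) = j.
Proof.
move=> ij; set o0 := Ordinal _; set o1 := Ordinal _; pose k := tperm o0 i j.
have k0 : k != o0 by rewrite -(tpermR o0 i) (inj_eq perm_inj) eq_sym.
exists (tperm o1 k * tperm o0 i)%g; split; rewrite permM.
  by rewrite (tpermD (isT : o1 != o0) k0) tpermL.
by rewrite tpermL tpermK.
Qed.

Lemma oddz_expand (x : int) : ~~ (2 %| x)%Z -> exists y, x = 2 * y + 1.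
Proof. by exists (x %/ 2)%Z; lia. Qed.

(** Four cases in order: some odd entry, then some diagonal entry not divisible by 4, then some
    other such entry, then none. Each failed search is a divisibility that makes the off-diagonal
    block solvable for the next corner. *)
Lemma split_step (L : lat) n : rank_lat L = n.+1 ->
  exists X N : lat, [/\ (rank_lat N < n.+1)%N, L ≃ X ⊕ N &
    [\/ X ≃ lE, X ≃ lH, X ≃ lK | X ≃ scalar2_lat 1 \/ X ≃ zero_lat 1]].
Proof.
case: L => l A eA /= ln; subst l.
have [/existsP[i /existsP[j oij]]|allev] := boolP [exists i, exists j, ~~ (2 %| A i j)%Z].
  have ij : i != j by apply: contraNneq oij => <-; apply: eA.2.
  case: n => [|n] in A eA i j oij ij *; first by rewrite !ord1 in ij.
  have [s [s0 s1]] := perm_front2 ij; have [eB AB] := eqv_perm eA s.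
  set B := row_perm _ _ in eB AB; pose M : 'M_2 := @ulsubmx _ 2 n 2 n B.
  have [sM evM] : even_sym M := @even_sym_ul 2 n B eB.
  have M01 : M 0 1 = A i j by rewrite !mxE -s0 -s1; congr (A (s _) (s _)); apply: val_inj.
  have M10 : M 1 0 = M 0 1 by rewrite -[in LHS]sM mxE.
  have [a Ma] := dvdzP (evM 0); have [c Mc] := dvdzP (evM 1).
  have ME : M = mx2 (2 * a) (A i j) (A i j) (2 * c).
    by rewrite [LHS]mx2E M10 M01 Ma Mc ![_ * 2]mulrC.
  (* [D] is the determinant of the corner [M] and [N'] the adjugate. As [D] is odd, its square is 1
     modulo 4 and [D *: N'] inverts [M] modulo 4. *)
  pose D := 4 * (a * c) - A i j * A i j.
  pose N' := mx2 (2 * c) (- A i j) (- A i j) (2 * a).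
  have MN : M *m N' = D%:M.
    rewrite ME mx2M [RHS]mx2E !mxE /= /D; congr mx2; ring.
  have [f Df] : exists f, D * D = 1 + 4 * f.
    have [x xE] := oddz_expand oij.
    (* The first factor is y with [D = 2 y + 1], and the square of [D] is 1 + 4 y (y + 1). *)
    exists ((2 * (a * c) - 2 * (x * x) - 2 * x - 1) *
            (2 * (a * c) - 2 * (x * x) - 2 * x)).
    rewrite /D xE; ring.
  have [|N [rN BN]] := @eqv_split 2 n B eB
      (D *: N' *m @ursubmx _ 2 n 2 n B) (f *: @ursubmx _ 2 n 2 n B).
    rewrite -scalemxAl -scalemxAr mulmxA MN mul_scalar_mx scalerA.
    by rewrite Df scalerDl scale1r scalerA.
  exists (Lat (@even_sym_ul 2 n B eB)), N; split.
  - by rewrite rN.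
  - by rewrite AB.
  have [] := @eqv_odd2 (Lat (@even_sym_ul 2 n B eB)) erefl a (A i j) c _ oij.
  - by rewrite castmx_id.
  - by move=> h; apply: Or41.
  - by move=> h; apply: Or42.
have {}allev i j : exists y, A i j = 2 * y.
  have := allev; rewrite negb_exists => /forallP/(_ i).
  rewrite negb_exists => /forallP/(_ j); rewrite negbK => /dvdzP[y ->].
  by exists y; rewrite mulrC.
have [/existsP[i oi]|diag4] := boolP [exists i, ~~ (4 %| A i i)%Z].
  have [eB AB] := eqv_perm eA (tperm ord0 i).
  set B := row_perm _ _ in eB AB; pose M : 'M_1 := @ulsubmx _ 1 n 1 n B.
  have M00 : M 0 0 = A i i.
    by rewrite !mxE (_ : lshift n 0 = ord0) ?tpermL //; apply: val_inj.
  have evB (j : 'I_n) : exists y, (@ursubmx _ 1 n 1 n B) 0 j = 2 * y.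
    by rewrite !mxE; apply: allev.
  have [u Au] := allev i i.
  have [v uv] : exists v, u = 2 * v + 1 by apply: oddz_expand; lia.
  have [g gE] := choice evB.
  (* The corner is 4 v + 2 and the row next to it is 2 g, so g solves the equation with error 4 v
     g. *)
  have [|N [rN BN]] := @eqv_split 1 n B eB (\row_j g j) (v *: \row_j g j).
    apply/matrixP=> k j; rewrite ord1 mxE big_ord1 [M 0 0]M00 Au uv.
    by rewrite [RHS]mxE gE !mxE; ring.
  exists (Lat (@even_sym_ul 1 n B eB)), N; split.
  - by rewrite rN.
  - by rewrite AB.
  apply: Or44; left.
  refine (@eqv_gram (Lat (@even_sym_ul 1 n B eB)) (scalar2_lat 1) erefl _) => k j.
  rewrite /= !ord1 [M 0 0]M00 Au uv !mxE /=; lia.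
have {}diag4 i : (4 %| A i i)%Z.
  by have := diag4; rewrite negb_exists => /forallP/(_ i); rewrite negbK.
have [/existsP[i /existsP[j oij]]|all4] := boolP [exists i, exists j, ~~ (4 %| A i j)%Z].
  have ij : i != j by apply: contraNneq oij => <-; apply: diag4.
  case: n => [|n] in A eA i j oij ij allev diag4 *; first by rewrite !ord1 in ij.
  have [s [s0 s1]] := perm_front2 ij; have [eB AB] := eqv_perm eA s.
  set B := row_perm _ _ in eB AB; pose M : 'M_2 := @ulsubmx _ 2 n 2 n B.
  have [sM _] : even_sym M := @even_sym_ul 2 n B eB.
  have M01 : M 0 1 = A i j by rewrite !mxE -s0 -s1; congr (A (s _) (s _)); apply: val_inj.
  have M10 : M 1 0 = A i j by rewrite -M01 -[in LHS]sM mxE.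
  have [a Ma] : exists a, M 0 0 = 4 * a.
    by have /dvdzP[y yE] := diag4 (s (lshift n (0 : 'I_2))); exists y; rewrite !mxE mulrC.
  have [c Mc] : exists c, M 1 1 = 4 * c.
    by have /dvdzP[y yE] := diag4 (s (lshift n (1 : 'I_2))); exists y; rewrite !mxE mulrC.
  have [u Au] := allev i j.
  have [v uv] : exists v, u = 2 * v + 1 by apply: oddz_expand; lia.
  have evB (k : 'I_2 * 'I_n) : exists y, (@ursubmx _ 2 n 2 n B) k.1 k.2 = 2 * y.
    by rewrite !mxE; apply: allev.
  have [g gE] := choice evB.
  (* Modulo 4 the corner is [[0,2],[2,0]], which exchanges the rows and doubles them, so [C] is half
     of the off-diagonal block with its rows exchanged; [F] collects the error. *)
  pose C : 'M_(2, n) := \matrix_(k, j) (if k == 0 then g (1, j) else g (0, j)).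
  pose F : 'M_(2, n) := \matrix_(k, j)
    (if k == 0 then a * g (1, j) + v * g (0, j) else c * g (0, j) + v * g (1, j)).
  have [|N [rN BN]] := @eqv_split 2 n B eB C F.
    rewrite [@ulsubmx _ 2 n 2 n B]mx2E [_ 0 1]M01 [_ 1 0]M10 [_ 0 0]Ma [_ 1 1]Mc Au uv.
    apply/matrixP=> k l; rewrite [LHS]mxE !big_ord_recl big_ord0 addr0.
    rewrite [RHS]mxE (gE (k, l)) !mxE /=.
    have [->|->] : k = 0 \/ k = 1.
      by case: k => [[|[|//]] ?]; [left | right]; apply: val_inj.
    + by rewrite /=; ring.
    by rewrite /=; ring.
  exists (Lat (@even_sym_ul 2 n B eB)), N; split.
  - by rewrite rN.
  - by rewrite AB.
  apply: Or43; refine (@eqv_gram (Lat (@even_sym_ul 2 n B eB)) lK erefl _) => k l.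
  rewrite !cast_ord_id /= -/M [M]mx2E M01 M10 Ma Mc Au uv !mxE.
  by case: (k == 0); case: (l == 0); lia.
have {}all4 i j : (4 %| A i j)%Z.
  have := all4; rewrite negb_exists => /forallP/(_ i).
  by rewrite negb_exists => /forallP/(_ j); rewrite negbK.
have ev4 (j : 'I_n) : exists y, (@ursubmx _ 1 n 1 n A) 0 j = 4 * y.
  by rewrite !mxE; have /dvdzP[y ->] := all4 (lshift n (0 : 'I_1)) (rshift 1 j);
    exists y; rewrite mulrC.
have [g gE] := choice ev4.
(* Every entry is divisible by 4, so any index splits off a zero block with no change of basis. *)
have [|N [rN AN]] := @eqv_split 1 n A eA 0 (- \row_j g j).
  by apply/matrixP=> k j; rewrite ord1 mulmx0 [RHS]mxE gE !mxE; ring.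
exists (Lat (@even_sym_ul 1 n A eA)), N; split=> //; first by rewrite rN.
apply: Or44; right.
refine (@eqv_gram (Lat (@even_sym_ul 1 n A eA)) (zero_lat 1) erefl _) => k j.
by rewrite /= !ord1 !mxE subr0.
Qed.

Lemma eqv_nf_lat L : exists d, L ≃ nf_lat d.
Proof.
move: {2}(rank_lat L) (erefl (rank_lat L)) => n; elim/ltn_ind: n L => n IHn L Ln.
case: n => [|n] in IHn Ln *.
  exists (NFParams 0 0 0 0 0).
  have e : rank_lat L = rank_lat (nf_lat (NFParams 0 0 0 0 0)).
    by rewrite Ln /= !big_ord0.
  by apply: (eqv_gram (e := e)) => i; exfalso; have := ltn_ord i; rewrite {2}Ln.
have [X [N [ltN LX hX]]] := split_step Ln.
have [[r s t p m] Nd] := IHn _ ltN N erefl.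
case: hX => [XE|XE|XE|[XE|XE]].
- by exists (NFParams r.+1 s t p m); rewrite LX XE Nd nf_addE.
- by exists (NFParams r s.+1 t p m); rewrite LX XE Nd nf_addH.
- by exists (NFParams r s t.+1 p m); rewrite LX XE Nd nf_addK.
- by exists (NFParams r s t p.+1 m); rewrite LX XE Nd nf_addD.
- by exists (NFParams r s t p m.+1); rewrite LX XE Nd nf_addZ.
Qed.

(** * Normal forms as congruences modulo 4 *)

Lemma normal_form_eqv n (A : 'M[int]_n) (eA : even_sym A) d :
  normal_form A d -> Lat eA ≃ nf_lat d.
Proof.
move=> [en [P [dP h]]].
have PQ : P *m invmx P = 1%:M.
  by rewrite mulmxV // unitmxE; case: dP => ->.
apply: eqv_trans (eqv_conj (L := Lat eA) PQ) _.
refine (@eqv_gram (Lat (even_sym_conj P eA)) (nf_lat d) en _) => i j.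
rewrite -[gram (nf_lat d)]/(nf_mx d) -h castmxE !cast_ordK [map_mx _ _ _ _]mxE /=.
by move: ((P^T *m A *m P) i j) => x; lia.
Qed.

Definition mod4 (a : int) : int := (a %% 4)%Z.

Lemma map_mod4_block m n (A : 'M[int]_m) (B : 'M[int]_n) :
  map_mx mod4 A = A -> map_mx mod4 B = B ->
  map_mx mod4 (block_mx A 0 0 B) = block_mx A 0 0 B.
Proof.
move=> hA hB; rewrite map_block_mx hA hB.
by congr block_mx; apply/matrixP=> i j; rewrite !mxE.
Qed.

Lemma map_mod4_copies k B : map_mx mod4 B = B -> map_mx mod4 (copies k B) = copies k B.
Proof.
move=> hB; elim: k => [|k IHk]; last first.
  by rewrite copiesS map_castmx map_mod4_block.
by apply/matrixP=> i; exfalso; have := ltn_ord i; rewrite {2}big_ord0.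
Qed.

(** All entries of a normal form are 0, 1 or 2, hence fixed by the reduction; a congruence modulo 4
    therefore gives the equality that [normal_form] demands. *)
Lemma map_mod4_nf d : map_mx mod4 (nf_mx d) = nf_mx d.
Proof.
have mx2_mod4 a b c e : mod4 a = a -> mod4 b = b -> mod4 c = c -> mod4 e = e ->
    map_mx mod4 (mx2 a b c e) = mx2 a b c e.
  by move=> *; apply/matrixP=> i j; rewrite !mxE; case: (i == 0); case: (j == 0).
do 3 (apply: map_mod4_block; first by apply: map_mod4_copies; apply: mx2_mod4).
apply: map_mod4_block; last by apply/matrixP=> i j; rewrite !mxE.
by apply/matrixP=> i j; rewrite !mxE; case: (i == j).
Qed.

Lemma eqv_normal_form n (A : 'M[int]_n) (eA : even_sym A) d :
  Lat eA ≃ nf_lat d -> normal_form A d.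
Proof.
move=> AN; have /= en := eqv_rank AN; subst n.
have [P [Q [E [PQ QP hE]]]] := AN; exists erefl, P; split.
  have : \det Q * \det P = 1 by rewrite -det_mulmx QP det1.
  by move=> /intUnitRing.unitzPl/orP[/eqP ->|/eqP ->]; [left | right].
rewrite castmx_id hE gram_nf_lat -[in RHS]map_mod4_nf.
apply/matrixP=> i j; rewrite !mxE /mod4.
move: (E i j) (nf_mx d i j) => x y; lia.
Qed.

(** * The quadratic form over F_2 and the radical of Omega *)

Lemma F2_cases (a : 'F_2) : a = 0 \/ a = 1.
Proof. by case: a => [[|[|//]] ?]; [left | right]; apply: val_inj. Qed.

Lemma intrF2_even (a : int) : (2 %| a)%Z -> a%:~R = 0 :> 'F_2.
Proof. by rewrite -intrF2_eq0 => /eqP. Qed.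

Lemma redD n (v w : 'cV[int]_n) : red (v + w) = red v + red w.
Proof. exact: map_mxD. Qed.

Lemma red_eq0 n (v : 'cV[int]_n) : (forall i, (2 %| v i 0%R)%Z) -> red v = 0.
Proof. by move=> h; apply/colP=> i; rewrite !mxE; apply: intrF2_even. Qed.

Section QuadraticForm.
Variables (n : nat) (A : 'M[int]_n).
Hypothesis eA : even_sym A.

Lemma qformD x y : qform A (x + y) = qform A x + qform A y + Omega A x y.
Proof.
rewrite -[x]red_liftZ -[y]red_liftZ -redD !qform_red ?Omega_red ?eA.1 //.
move: (liftZ x) (liftZ y) => v w; rewrite !(bformDl, bformDr) (bformC w v eA.1).
have [a ->] := dvdzP (bform_even v eA); have [c ->] := dvdzP (bform_even w eA).
rewrite !mulzK //; set b := bform A v w.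
have -> : a * 2 + b + (b + c * 2) = (a + c + b) * 2 by ring.
by rewrite mulzK // !rmorphD.
Qed.

Lemma OmegaE x y : Omega A x y = qform A (x + y) - qform A x - qform A y.
Proof. by rewrite qformD; ring. Qed.

Lemma Vbar0P x : reflect (forall y, Omega A x y = 0) (x \in Vbar0 A).
Proof.
apply: (iffP idP) => [/mem_Vbar0[v v0 <-] y|h].
  by rewrite -[y]red_liftZ Omega_red; apply: intrF2_even.
apply/mem_Vbar0; exists (liftZ x); last exact: red_liftZ.
by move=> w; rewrite -intrF2_eq0 -Omega_red red_liftZ h.
Qed.

Lemma card_Vbar_sum (V : {vspace Vbar n}) :
  \sum_x (x \in V)%:R = (2 ^ \dim V)%N%:R :> int.
Proof.
have <- : #|V| = (2 ^ \dim V)%N by rewrite card_vspace card_Fp.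
rewrite -natr_sum -sum1_card [in RHS]big_mkcond.
by congr _%:R.
Qed.

End QuadraticForm.

(** * Gauss sum, cardinals and vanishing of q as invariants *)

Definition chi (a : 'F_2) : int := if a == 0 then 1 else -1.

Lemma chiD a b : chi (a + b) = chi a * chi b.
Proof. by have [->|->] := F2_cases a; have [->|->] := F2_cases b. Qed.

Definition gauss n (A : 'M[int]_n) : int := \sum_x chi (qform A x).

Definition q_vanishes n (A : 'M[int]_n) : bool :=
  [forall x, (x \in Vbar0 A) ==> (qform A x == 0)].

(** Cardinals are written as integer sums of indicator functions, so that they factor over
    orthogonal sums by the same lemma as the Gauss sum. *)
Definition count0 n (A : 'M[int]_n) : int := \sum_x (x \in Vbar0 A)%:R.
Definition count000 n (A : 'M[int]_n) : int := \sum_x (x \in Vbar000 A)%:R.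

Section Isometry.
Variables (n m : nat) (A : 'M[int]_n) (B : 'M[int]_m) (phi : Vbar m -> Vbar n).
Hypotheses (eA : even_sym A) (eB : even_sym B) (phi_bij : bijective phi).
Hypotheses (phiD : {morph phi : x y / x + y}).
Hypothesis (phi_q : forall x, qform A (phi x) = qform B x).

(** Polarisation recovers Omega from q; hence an additive bijection that respects q also respects
    the radical. *)
Lemma Omega_iso x y : Omega A (phi x) (phi y) = Omega B x y.
Proof. by rewrite !OmegaE // -phiD !phi_q. Qed.

Lemma Vbar0_iso x : (phi x \in Vbar0 A) = (x \in Vbar0 B).
Proof.
have [psi phiK psiK] := phi_bij.
apply/Vbar0P/Vbar0P => // h y; first by rewrite -Omega_iso.
by rewrite -[y]psiK Omega_iso.
Qed.

Lemma gauss_iso : gauss A = gauss B.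
Proof.
rewrite /gauss (reindex phi) /=; last exact: onW_bij.
by apply: eq_bigr => x _; rewrite phi_q.
Qed.

Lemma count0_iso : count0 A = count0 B.
Proof.
rewrite /count0 (reindex phi) /=; last exact: onW_bij.
by apply: eq_bigr => x _; rewrite Vbar0_iso.
Qed.

Lemma q_vanishes_iso : q_vanishes A = q_vanishes B.
Proof.
have [psi phiK psiK] := phi_bij.
apply/forallP/forallP => h x; first by rewrite -phi_q -Vbar0_iso.
by rewrite -[x]psiK phi_q Vbar0_iso.
Qed.

End Isometry.

Section EqvIsometry.
Variables (L M : lat) (P : 'M[int]_(rank_lat L, rank_lat M)).
Variables (Q : 'M[int]_(rank_lat M, rank_lat L)) (E : 'M[int]_(rank_lat M)).
Hypotheses (PQ : P *m Q = 1%:M) (QP : Q *m P = 1%:M).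
Hypothesis PE : P^T *m L *m P = gram M + 4 *: E.

Definition redmul (x : Vbar (rank_lat M)) : Vbar (rank_lat L) :=
  map_mx intr P *m x.

Lemma red_mulmx v : red (P *m v) = redmul (red v).
Proof. exact: map_mxM. Qed.

Lemma redmul_bij : bijective redmul.
Proof.
exists (fun x => map_mx intr Q *m x) => x; rewrite /redmul mulmxA -map_mxM.
  by rewrite QP map_mx1 mul1mx.
by rewrite PQ map_mx1 mul1mx.
Qed.

Lemma bform_eqv v w : bform L (P *m v) (P *m w) = bform M v w + 4 * bform E v w.
Proof.
rewrite -bform_conj PE /bform mulmxDr mulmxDl mxE; congr (_ + _).
by rewrite -scalemxAr -scalemxAl mxE.
Qed.

(** Adding [4 *: E] changes half of a norm by an even number, so q depends on the Gram matrix modulo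
    4 only. *)
Lemma redmul_q x : qform L (redmul x) = qform M x.
Proof.
rewrite -[in LHS](red_liftZ x) -red_mulmx qform_red ?(gramP L).1 // bform_eqv.
rewrite /qform; have [a ->] := dvdzP (bform_even (liftZ x) (gramP M)).
move: (bform E _ _) => c; have -> : a * 2 + 4 * c = (a + 2 * c) * 2 by ring.
rewrite !mulzK // rmorphD /= [X in _ + X]intrF2_even ?addr0 //.
exact: dvdz_mulr.
Qed.

Lemma redmulD : {morph redmul : x y / x + y}.
Proof. by move=> x y; rewrite /redmul mulmxDr. Qed.

(** Any test vector is [P *m (Q *m w)], so divisibility by 4 is carried along [P]. The converse
    inclusion comes from the same lemma applied to [Q]. *)
Lemma Vbar000_redmul x : x \in Vbar000 M -> redmul x \in Vbar000 L.
Proof.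
move=> /mem_Vbar000[v [v0 v4] <-]; apply/mem_Vbar000; exists (P *m v); last first.
  exact: red_mulmx.
have h4 w : (4 %| bform L (P *m v) w)%Z.
  rewrite -[w]mul1mx -PQ -mulmxA bform_eqv rpredD ?v4 //.
  exact: dvdz_mulr.
by split=> w //; have := h4 w; lia.
Qed.

End EqvIsometry.

Lemma gauss_eqv L M : L ≃ M -> gauss L = gauss M.
Proof.
move=> [P] [Q] [E] [PQ QP PE]; apply: (gauss_iso (phi := redmul P)).
- exact: redmul_bij PQ QP.
- exact: redmul_q PE.
Qed.

Lemma count0_eqv L M : L ≃ M -> count0 L = count0 M.
Proof.
move=> [P] [Q] [E] [PQ QP PE].
apply: (count0_iso (phi := redmul P)) (gramP L) (gramP M) _ _ _.
- exact: redmul_bij PQ QP.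
- exact: redmulD.
- exact: redmul_q PE.
Qed.

Lemma q_vanishes_eqv L M : L ≃ M -> q_vanishes L = q_vanishes M.
Proof.
move=> [P] [Q] [E] [PQ QP PE].
apply: (q_vanishes_iso (phi := redmul P)) (gramP L) (gramP M) _ _ _.
- exact: redmul_bij PQ QP.
- exact: redmulD.
- exact: redmul_q PE.
Qed.

(** This invariant is not a function of q: [[0,2],[2,0]] and the zero matrix of size 2 have the same
    q. The congruence of matrices itself is therefore used. *)
Lemma count000_eqv L M : L ≃ M -> count000 L = count000 M.
Proof.
move=> [P] [Q] [E] [PQ QP PE].
rewrite /count000 (reindex (redmul P)) /=; last exact/onW_bij/(redmul_bij PQ QP).
apply: eq_bigr => x _; congr (nat_of_bool _)%:R; apply/idP/idP; last first.
  by move=> h; exact: (Vbar000_redmul PQ PE).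
move=> /(Vbar000_redmul QP (gram_inverse PQ PE)).
by rewrite /redmul mulmxA -map_mxM QP map_mx1 mul1mx.
Qed.

(** * Multiplicativity over orthogonal sums *)

Lemma bform_block m n (A : 'M[int]_m) (B : 'M[int]_n) v w :
  bform (block_mx A 0 0 B) v w =
  bform A (usubmx v) (usubmx w) + bform B (dsubmx v) (dsubmx w).
Proof.
rewrite /bform -{1}[v]vsubmxK -{1}[w]vsubmxK tr_col_mx mul_row_block mul_row_col.
by rewrite !mulmx0 addr0 add0r mxE.
Qed.

Lemma Omega_block m n (A : 'M[int]_m) (B : 'M[int]_n) x y :
  Omega (block_mx A 0 0 B) x y =
  Omega A (usubmx x) (usubmx y) + Omega B (dsubmx x) (dsubmx y).
Proof.
rewrite /Omega bform_block rmorphD; congr (_ %:~R + _ %:~R);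
  by congr bform; rewrite /liftZ ?map_usubmx ?map_dsubmx.
Qed.

Lemma qform_block m n (A : 'M[int]_m) (B : 'M[int]_n) x :
  even_sym A -> qform (block_mx A 0 0 B) x = qform A (usubmx x) + qform B (dsubmx x).
Proof.
move=> eA; rewrite /qform bform_block divzDl ?bform_even // rmorphD.
by rewrite /liftZ ?map_usubmx ?map_dsubmx.
Qed.

Lemma Vbar0_block m n (A : 'M[int]_m) (B : 'M[int]_n) x :
  (x \in Vbar0 (block_mx A 0 0 B)) = (usubmx x \in Vbar0 A) && (dsubmx x \in Vbar0 B).
Proof.
apply/Vbar0P/andP => [h|[/Vbar0P hu /Vbar0P hd] y]; last first.
  by rewrite Omega_block hu hd addr0.
have Omega0 k (C : 'M[int]_k) z : Omega C z 0 = 0.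
  have -> : (0 : Vbar k) = red 0 by rewrite /red map_mx0.
  rewrite -[z]red_liftZ Omega_red.
  by rewrite -(scale0r 0) bformZr mul0r.
split; apply/Vbar0P => y.
  by have := h (col_mx y 0); rewrite Omega_block col_mxKu col_mxKd Omega0 addr0.
by have := h (col_mx 0 y); rewrite Omega_block col_mxKu col_mxKd Omega0 add0r.
Qed.

Lemma Vbar000_block m n (A : 'M[int]_m) (B : 'M[int]_n) x :
  (x \in Vbar000 (block_mx A 0 0 B)) =
  (usubmx x \in Vbar000 A) && (dsubmx x \in Vbar000 B).
Proof.
have V000E k (C : 'M[int]_k) v : V000 C v <-> forall w, (4 %| bform C v w)%Z.
  by split=> [[]//|h]; split=> // w; have := h w; lia.
have bform0 k (C : 'M[int]_k) z : bform C z 0 = 0.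
  by rewrite -(scale0r 0) bformZr mul0r.
apply/idP/andP => [/mem_Vbar000[v /V000E hv <-]|].
  split; apply/mem_Vbar000.
    exists (usubmx v); last by rewrite /red map_usubmx.
    apply/V000E => w; have := hv (col_mx w 0).
    by rewrite bform_block col_mxKu col_mxKd bform0 addr0.
  exists (dsubmx v); last by rewrite /red map_dsubmx.
  apply/V000E => w; have := hv (col_mx 0 w).
  by rewrite bform_block col_mxKu col_mxKd bform0 add0r.
move=> [/mem_Vbar000[u /V000E hu ux] /mem_Vbar000[w /V000E hw wx]].
apply/mem_Vbar000; exists (col_mx u w); last first.
  by rewrite -[x]vsubmxK -ux -wx /red map_col_mx.
by apply/V000E => v; rewrite bform_block col_mxKu col_mxKd rpredD.
Qed.

Lemma sum_col_mx m n (f : Vbar (m + n) -> int) :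
  \sum_z f z = \sum_x \sum_y f (col_mx x y).
Proof.
rewrite pair_bigA /= (reindex (fun z : Vbar m * Vbar n => col_mx z.1 z.2)) //.
exists (fun z => (usubmx z, dsubmx z)) => [[x y] _ | z _] /=.
  by rewrite col_mxKu col_mxKd.
by rewrite vsubmxK.
Qed.

Lemma sum_block m n (f : Vbar (m + n) -> int) (g : Vbar m -> int) (h : Vbar n -> int) :
  (forall z, f z = g (usubmx z) * h (dsubmx z)) ->
  \sum_z f z = (\sum_x g x) * (\sum_y h y).
Proof.
move=> fE; rewrite sum_col_mx big_distrl; apply: eq_bigr => x _ /=.
by rewrite big_distrr; apply: eq_bigr => y _; rewrite fE col_mxKu col_mxKd.
Qed.

(** Such a function is determined on every normal form by its values on the five blocks, see
    [mult_nf]. Rank 0 is an equation because the rank of an empty family of copies is an empty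
    sum. *)
Record multiplicative (f : lat -> int) : Prop := Multiplicative {
  mult_eqv : forall L M, L ≃ M -> f L = f M;
  mult_osum : forall L M, f (L ⊕ M) = f L * f M;
  mult_rank0 : forall L, rank_lat L = 0%N -> f L = 1 }.

Lemma Vbar_rank0 (L : lat) : rank_lat L = 0%N -> forall x : Vbar (rank_lat L), x = 0.
Proof. by case: L => n A eA /= n0; subst n => x; apply: flatmx0. Qed.

Lemma sum_rank0 (L : lat) (f : Vbar (rank_lat L) -> int) :
  rank_lat L = 0%N -> \sum_x f x = f 0.
Proof.
move=> /Vbar_rank0 L0; rewrite (bigD1 0) //= big1 ?addr0 // => x.
by rewrite (L0 x) eqxx.
Qed.

Lemma qform0 n (A : 'M[int]_n) : qform A 0 = 0.
Proof.
rewrite /qform; have -> : liftZ 0 = 0 :> 'cV_n by apply/matrixP=> i j; rewrite !mxE.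
by rewrite -(scale0r 0) bformZr mul0r div0z.
Qed.

Lemma gauss_mult : multiplicative (fun L => gauss L).
Proof.
split=> [|L M|L L0]; first exact: gauss_eqv.
  by apply: sum_block => z; rewrite -chiD qform_block //; apply: gramP.
by rewrite /gauss sum_rank0 // qform0.
Qed.

Lemma count0_mult : multiplicative (fun L => count0 L).
Proof.
split=> [|L M|L L0]; first exact: count0_eqv.
  by apply: sum_block => z; rewrite Vbar0_block -mulnb natrM.
by rewrite /count0 sum_rank0 // mem0v.
Qed.

Lemma count000_mult : multiplicative (fun L => count000 L).
Proof.
split=> [|L M|L L0]; first exact: count000_eqv.
  by apply: sum_block => z; rewrite Vbar000_block -mulnb natrM.
by rewrite /count000 sum_rank0 // mem0v.
Qed.

Lemma q_vanishesP n (A : 'M[int]_n) :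
  reflect (forall x, x \in Vbar0 A -> qform A x = 0) (q_vanishes A).
Proof.
apply: (iffP forallP) => h x; first by have := h x; move/implyP=> h' /h'/eqP.
by apply/implyP=> /h/eqP.
Qed.

(** The radical of a sum is the sum of the radicals and q adds over it, so the truth values, taken
    as 0 and 1, multiply. *)
Lemma q_vanishes_mult : multiplicative (fun L => (q_vanishes L)%:R).
Proof.
split=> [L M /q_vanishes_eqv -> //|L M|L L0]; last first.
  rewrite (_ : q_vanishes L) //; apply/q_vanishesP => x _.
  by rewrite (Vbar_rank0 L0 x) qform0.
rewrite -natrM mulnb; congr (nat_of_bool _)%:R.
apply/q_vanishesP/andP => [h|[/q_vanishesP hL /q_vanishesP hM] x].
  split; apply/q_vanishesP => x hx.
    have := h (col_mx x 0); rewrite Vbar0_block qform_block; last exact: gramP.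
    by rewrite col_mxKu col_mxKd qform0 addr0 mem0v hx; apply.
  have := h (col_mx 0 x); rewrite Vbar0_block qform_block; last exact: gramP.
  by rewrite col_mxKu col_mxKd qform0 add0r mem0v hx; apply.
rewrite Vbar0_block qform_block; last exact: gramP.
by move=> /andP[/hL -> /hM ->]; rewrite addr0.
Qed.

Lemma mult_nf f d : multiplicative f ->
  f (nf_lat d) = f lE ^+ nf_r d * f lH ^+ nf_s d * f lK ^+ nf_t d *
                 f (scalar2_lat 1) ^+ nf_p d * f (zero_lat 1) ^+ nf_m d.
Proof.
move=> mf; have fS k B (eB : even_sym B) : f (copies_lat k eB) = f (Lat eB) ^+ k.
  elim: k => [|k IHk]; first by apply: (mult_rank0 mf); rewrite /= big_ord0.
  by rewrite (mult_eqv mf (copies_latS _ _)) (mult_osum mf) IHk exprS.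
have fD k : f (scalar2_lat k) = f (scalar2_lat 1) ^+ k.
  elim: k => [|k IHk]; first exact: (mult_rank0 mf).
  by rewrite (mult_eqv mf (scalar2_latS _)) (mult_osum mf) IHk exprS.
have fZ k : f (zero_lat k) = f (zero_lat 1) ^+ k.
  elim: k => [|k IHk]; first exact: (mult_rank0 mf).
  by rewrite (mult_eqv mf (zero_latS _)) (mult_osum mf) IHk exprS.
by rewrite /nf_lat !(mult_osum mf) !fS fD fZ !mulrA.
Qed.

(** * Values of the invariants on the blocks *)

Lemma sum_F2 (g : 'F_2 -> int) : \sum_a g a = g 0 + g 1.
Proof.
rewrite !big_ord_recl big_ord0 addr0; congr (_ + _); congr g; exact: val_inj.
Qed.

Lemma sum_Vbar1 (f : Vbar 1 -> int) : \sum_x f x = f 0 + f (const_mx 1).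
Proof.
rewrite (reindex (fun a : 'F_2 => const_mx a)) /= ?sum_F2 ?const_mx0 //.
exists (fun x : Vbar 1 => x 0 0) => [a _|x _]; first by rewrite mxE.
by apply/matrixP=> i j; rewrite !ord1 mxE.
Qed.

Definition col2 (a b : 'F_2) : Vbar 2 := \col_i (if i == 0 then a else b).

Lemma col2E (x : Vbar 2) : x = col2 (x 0 0) (x 1 0).
Proof.
apply/colP => i; rewrite mxE.
by case: i => [[|[|//]] ?]; congr (x _ _); apply: val_inj.
Qed.

Lemma sum_Vbar2 (f : Vbar 2 -> int) :
  \sum_x f x = f (col2 0 0) + f (col2 0 1) + (f (col2 1 0) + f (col2 1 1)).
Proof.
rewrite (reindex (fun c : 'F_2 * 'F_2 => col2 c.1 c.2)) /=.
  by rewrite -(pair_bigA _ (fun a b => f (col2 a b))) /= sum_F2 !sum_F2.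
exists (fun x : Vbar 2 => (x 0 0, x 1 0)) => [[a b] _|x _]; first by rewrite !mxE.
by rewrite -col2E.
Qed.

Lemma bform_mx2 a b c d v w :
  bform (mx2 a b c d) v w = v 0 0 * a * w 0 0 + v 0 0 * b * w 1 0
                           + (v 1 0 * c * w 0 0 + v 1 0 * d * w 1 0).
Proof.
rewrite bformE !big_ord_recl !big_ord0 !mxE /= !addr0.
by rewrite (_ : lift ord0 ord0 = 1) //; apply: val_inj.
Qed.

Lemma liftZ_intr n (x : Vbar n) i : (liftZ x i 0)%:~R = x i 0.
Proof. by have /matrixP/(_ i 0) := red_liftZ x; rewrite mxE. Qed.

Lemma qform_mx2 p q s (x : Vbar 2) :
  qform (mx2 (2 * p) q q (2 * s)) x =
  p%:~R * (x 0 0 * x 0 0) + q%:~R * (x 0 0 * x 1 0) + s%:~R * (x 1 0 * x 1 0).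
Proof.
rewrite /qform bform_mx2 -!liftZ_intr; move: (liftZ x 0 0) (liftZ x 1 0) => a b.
have -> : a * (2 * p) * a + a * q * b + (b * q * a + b * (2 * s) * b) =
  (p * (a * a) + q * (a * b) + s * (b * b)) * 2 by ring.
by rewrite mulzK // !(rmorphD, rmorphM).
Qed.

Lemma qform_1 (A : 'M[int]_1) p (x : Vbar 1) :
  A 0 0 = 2 * p -> qform A x = p%:~R * (x 0 0 * x 0 0).
Proof.
move=> Ap; rewrite /qform bformE !big_ord1 Ap -!liftZ_intr.
move: (liftZ x 0 0) => a.
have -> : a * (2 * p) * a = (p * (a * a)) * 2 by ring.
by rewrite mulzK // !rmorphM.
Qed.

(** Modulo 2 the matrix is [[0,1],[1,0]], so pairing with the basis vectors reads off both
    coordinates. *)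
Lemma Vbar0_odd2 a b c x : ~~ (2 %| b)%Z ->
  x \in Vbar0 (mx2 (2 * a) b b (2 * c)) -> x = 0.
Proof.
move=> ob /mem_Vbar0[v v0 <-]; have [y bE] := oddz_expand ob.
have := v0 (delta_mx 0 0); have := v0 (delta_mx 1 0).
rewrite !bform_mx2 !mxE /= !(mulr0, mulr1, addr0, add0r) bE => h0 h1.
apply: red_eq0 => i; rewrite -[v i 0]/((fun k => v k 0) i).
case: i => [[|[|//]] ?] /=.
  rewrite (_ : Ordinal _ = 0); last exact: val_inj.
  by move: (v 0 0) (v 1 0) h0 h1 => p q; lia.
rewrite (_ : Ordinal _ = 1); last exact: val_inj.
by move: (v 0 0) (v 1 0) h0 h1 => p q; lia.
Qed.

Lemma Vbar000_lK x : x \in Vbar000 lK -> x = 0.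
Proof.
move=> /mem_Vbar000[v [_ v0] <-].
have := v0 (delta_mx 0 0); have := v0 (delta_mx 1 0).
rewrite !bform_mx2 !mxE /= !(mulr0, mulr1, addr0, add0r, mul0r) => h0 h1.
apply: red_eq0 => i; case: i => [[|[|//]] ?] /=.
  by rewrite (_ : Ordinal _ = 0); [lia | exact: val_inj].
by rewrite (_ : Ordinal _ = 1); [lia | exact: val_inj].
Qed.

Lemma Vbar000_scalar2 x : x \in Vbar000 (scalar2_lat 1) -> x = 0.
Proof.
move=> /mem_Vbar000[v [_ v0] <-].
have := v0 (delta_mx 0 0); rewrite bformE !big_ord1 !mxE !eqxx mulr1n mulr1 => h0.
by apply: red_eq0 => i; rewrite ord1; move: (v 0 0) h0 => a; lia.
Qed.

Lemma Vbar0_even n (A : 'M[int]_n) x :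
  (forall i j, (2 %| A i j)%Z) -> x \in Vbar0 A.
Proof.
move=> hA; apply/mem_Vbar0; exists (liftZ x); last exact: red_liftZ.
move=> w; rewrite bformE; apply: rpred_sum => i _; apply: rpred_sum => j _.
by apply/dvdz_mulr/dvdz_mull.
Qed.

Lemma Vbar000_0 n x : x \in Vbar000 (0 : 'M_n).
Proof.
apply/mem_Vbar000; exists (liftZ x); last exact: red_liftZ.
by split=> w; rewrite /bform mulmx0 mul0mx mxE dvdz0.
Qed.

Lemma sum_eq0 n (P : pred (Vbar n)) : P 0 -> (forall x, P x -> x = 0) ->
  \sum_x (P x)%:R = 1 :> int.
Proof.
move=> P0 Px; rewrite (bigD1 0) //= P0 big1 // => x x0.
by case: (boolP (P x)) => // /Px /eqP; rewrite (negPf x0).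
Qed.

Lemma sum_allT n (P : pred (Vbar n)) : (forall x, P x) ->
  \sum_x (P x)%:R = (2 ^ n)%:R :> int.
Proof.
move=> Px; under eq_bigr => x _ do rewrite Px.
by rewrite -natr_sum sum1_card card_mx card_Fp // muln1.
Qed.

Lemma sub_Vbar0 n (A : 'M[int]_n) x : x \in Vbar000 A -> x \in Vbar0 A.
Proof. exact: (subvP (sub_Vbar000 A)). Qed.

Lemma even_lK i j : (2 %| lK i j)%Z.
Proof. by rewrite mxE; case: ifP; case: ifP. Qed.

Lemma even_scalar2 n i j : (2 %| scalar2_lat n i j)%Z.
Proof. by rewrite mxE; case: (i == j). Qed.

Lemma even_zero n i j : (2 %| zero_lat n i j)%Z.
Proof. by rewrite mxE. Qed.

(** E and H are nondegenerate modulo 2 and contribute 1; K, D and (0) vanish modulo 2 and contribute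
    4, 2 and 2. *)
Lemma count0_nf d : count0 (nf_lat d) = 2 ^+ ((nf_t d).*2 + nf_p d + nf_m d).
Proof.
rewrite (mult_nf d count0_mult).
rewrite [count0 lE]sum_eq0 ?mem0v //; last by move=> x; apply: Vbar0_odd2.
rewrite [count0 lH]sum_eq0 ?mem0v //; last by move=> x; apply: Vbar0_odd2.
rewrite [count0 lK]sum_allT; last by move=> x; apply/Vbar0_even/even_lK.
rewrite [count0 (scalar2_lat 1)]sum_allT; last by move=> x; apply/Vbar0_even/even_scalar2.
rewrite [count0 (zero_lat 1)]sum_allT; last by move=> x; apply/Vbar0_even/even_zero.
by rewrite !expr1n !mul1r !natrX -exprM mul2n !exprD.
Qed.

Lemma count000_nf d : count000 (nf_lat d) = 2 ^+ nf_m d.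
Proof.
rewrite (mult_nf d count000_mult).
rewrite [count000 lE]sum_eq0 ?mem0v //; last by move=> x /sub_Vbar0; apply: Vbar0_odd2.
rewrite [count000 lH]sum_eq0 ?mem0v //; last by move=> x /sub_Vbar0; apply: Vbar0_odd2.
rewrite [count000 lK]sum_eq0 ?mem0v //; last exact: Vbar000_lK.
rewrite [count000 (scalar2_lat 1)]sum_eq0 ?mem0v //; last exact: Vbar000_scalar2.
rewrite [count000 (zero_lat 1)]sum_allT; last exact: Vbar000_0.
by rewrite !expr1n !mul1r.
Qed.

Lemma qform_lK x : qform lK x = 0.
Proof.
by rewrite [LHS](qform_mx2 0 2 0) !mul0r add0r addr0 (_ : 2%:~R = 0) ?mul0r //;
  apply: val_inj.
Qed.

(** D is the only block on whose radical q takes the value 1, so the truth value is [0 ^+ p], which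
    is 1 exactly for p = 0. *)
Lemma q_vanishes_nf d : q_vanishes (nf_lat d) = (nf_p d == 0%N).
Proof.
have := mult_nf d q_vanishes_mult.
rewrite (_ : q_vanishes lE); last first.
  by apply/q_vanishesP => x /Vbar0_odd2 ->; rewrite ?qform0.
rewrite (_ : q_vanishes lH); last first.
  by apply/q_vanishesP => x /Vbar0_odd2 ->; rewrite ?qform0.
rewrite (_ : q_vanishes lK); last by apply/q_vanishesP => x _; apply: qform_lK.
rewrite (_ : q_vanishes (zero_lat 1)); last first.
  by apply/q_vanishesP => x _; rewrite (@qform_1 _ 0) ?mul0r // mxE.
rewrite (_ : q_vanishes (scalar2_lat 1) = false); last first.
  apply/negbTE/q_vanishesP => /(_ (const_mx 1)); rewrite (@qform_1 _ 1) ?mxE //.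
  by move=> /(_ (Vbar0_even _ (@even_scalar2 1))).
rewrite !expr1n !mul1r mulr1 expr0n.
by case: (q_vanishes _); case: eqP.
Qed.

(** On E, q is 1 at the three nonzero vectors, giving 1 - 3; on H it is 1 at (1, 1) only, giving 3 -
    1; on D the two terms cancel; on K and (0) it is 0 throughout. *)
Lemma gauss_nf d : gauss (nf_lat d) =
  (-2) ^+ nf_r d * 2 ^+ nf_s d * 4 ^+ nf_t d * 0 ^+ nf_p d * 2 ^+ nf_m d.
Proof.
rewrite (mult_nf d gauss_mult).
have -> : gauss lE = -2.
  by rewrite /gauss sum_Vbar2 !(qform_mx2 1 1 1) !mxE.
have -> : gauss lH = 2.
  by rewrite /gauss sum_Vbar2 !(qform_mx2 0 1 0) !mxE.
have -> : gauss lK = 4.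
  by rewrite /gauss sum_Vbar2 !qform_lK.
have -> : gauss (scalar2_lat 1) = 0.
  by rewrite /gauss sum_Vbar1 !(@qform_1 _ 1) ?mxE.
have -> : gauss (zero_lat 1) = 2.
  by rewrite /gauss sum_Vbar1 !(@qform_1 _ 0) ?mxE.
by [].
Qed.

Lemma gauss_nf_sign d : nf_p d = 0%N -> (0 < gauss (nf_lat d)) = ~~ odd (nf_r d).
Proof.
move=> p0; rewrite gauss_nf p0 expr0 mulr1 -[-2]mulN1r exprMn -signr_odd -!mulrA.
set y := 2 ^+ nf_r d * _; have y0 : 0 < y by rewrite !mulr_gt0 ?exprn_gt0.
case: (odd _); last by rewrite expr0 mul1r.
by rewrite expr1 mulN1r oppr_gt0 lt_gtF.
Qed.

(** * Symplectic bases and the Gauss sum *)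

Section OmegaBilinear.
Variables (n : nat) (A : 'M[int]_n).
Hypothesis eA : even_sym A.

Lemma OmegaDl x y z : Omega A (x + y) z = Omega A x z + Omega A y z.
Proof.
rewrite -[x]red_liftZ -[y]red_liftZ -[z]red_liftZ -redD !Omega_red bformDl.
exact: rmorphD.
Qed.

Lemma OmegaC x y : Omega A x y = Omega A y x.
Proof. by rewrite /Omega bformC ?eA.1. Qed.

Lemma OmegaDr x y z : Omega A x (y + z) = Omega A x y + Omega A x z.
Proof. by rewrite OmegaC OmegaDl !(OmegaC x). Qed.

Lemma Omega0 x : Omega A 0 x = 0.
Proof. by apply: (addrI (Omega A 0 x)); rewrite -OmegaDl !addr0. Qed.

Lemma OmegaZl a x y : Omega A (a *: x) y = a * Omega A x y.
Proof.
by have [->|->] := F2_cases a; rewrite ?scale0r ?scale1r ?mul0r ?mul1r ?Omega0.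
Qed.

Lemma OmegaZr a x y : Omega A x (a *: y) = a * Omega A x y.
Proof. by rewrite OmegaC OmegaZl OmegaC. Qed.

Lemma Omega_sumr I (r : seq I) (F : I -> Vbar n) x :
  Omega A x (\sum_(i <- r) F i) = \sum_(i <- r) Omega A x (F i).
Proof.
apply: (big_morph (Omega A x)) => [y z|]; first exact: OmegaDr.
by rewrite OmegaC Omega0.
Qed.

Lemma qformZ a x : qform A (a *: x) = a * qform A x.
Proof.
by have [->|->] := F2_cases a; rewrite ?scale0r ?scale1r ?mul0r ?mul1r ?qform0.
Qed.

Lemma qform_sum (I : eqType) (r : seq I) (F : I -> Vbar n) : uniq r ->
  (forall i j, i != j -> Omega A (F i) (F j) = 0) ->
  qform A (\sum_(i <- r) F i) = \sum_(i <- r) qform A (F i).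
Proof.
move=> ur orth; elim: r ur => [_|i r IHr /= /andP[ir ur]].
  by rewrite !big_nil qform0.
rewrite !big_cons qformD // IHr // [Omega _ _ _](_ : _ = 0) ?addr0 //.
rewrite Omega_sumr big_seq big1 // => j jr.
by apply: orth; apply: contraNneq ir => ->.
Qed.

Section SymplecticBasis.
Variables (k l : nat) (e f : k.-tuple (Vbar n)) (h : l.-tuple (Vbar n)).
Hypothesis efh : symplectic_basis A e f h.

Definition hyp_part (c : {ffun 'I_k -> 'F_2 * 'F_2}) (i : 'I_k) : Vbar n :=
  (c i).1 *: tnth e i + (c i).2 *: tnth f i.

(** The coordinates are grouped by hyperbolic pairs, as functions on ['I_k] and ['I_l], so that a
    sum over Vbar of products over the pairs can be distributed. *)
Definition symp_comb (c : {ffun 'I_k -> 'F_2 * 'F_2} * {ffun 'I_l -> 'F_2}) : Vbar n :=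
  \sum_i hyp_part c.1 i + \sum_j c.2 j *: tnth h j.

Lemma span_tuple m (X : m.-tuple (Vbar n)) x :
  x \in <<X>>%VS -> x = \sum_i coord X i x *: tnth X i.
Proof.
move=> /coord_span {1}->; apply: eq_bigr => i _; by rewrite -tnth_nth.
Qed.

Lemma symp_comb_surj x : exists c, symp_comb c = x.
Proof.
have [/andP[/eqP sp _] _ _ _ _] := efh.
have : x \in <<e ++ f ++ h>>%VS by rewrite sp memvf.
rewrite !span_cat => /memv_addP[x1 /span_tuple x1E [y /memv_addP[x2 /span_tuple x2E]]].
move=> [x3 /span_tuple x3E ->] ->.
exists ([ffun i => (coord e i x1, coord f i x2)], [ffun j => coord h j x3]).
rewrite /symp_comb addrA {3}x1E {3}x2E {3}x3E -big_split /=.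
by congr (_ + _); apply: eq_bigr => i _; rewrite /hyp_part ffunE.
Qed.

Lemma symp_size : n = (k.*2 + l)%N.
Proof.
have [/size_basis + _ _ _ _] := efh.
by rewrite dimvf /dim /= muln1 => ->; rewrite addnA addnn.
Qed.

(** Surjectivity is spanning; injectivity follows by counting, as there are 4^k 2^l = 2^n coordinate
    systems. *)
Lemma symp_comb_bij : bijective symp_comb.
Proof.
have [psi psiK] := choice symp_comb_surj.
apply: (bij_can_bij _ psiK); apply: inj_card_bij (can_inj psiK) _.
rewrite card_prod !card_ffun !card_ord card_prod card_mx card_Fp // muln1.
by rewrite expnMn -!expnD addnn -symp_size.
Qed.

Lemma symp_h_Vbar0 j : tnth h j \in Vbar0 A.
Proof.
have [_ _ _ hyp hh] := efh.
apply/Vbar0P => // y; have [c <-] := symp_comb_surj y.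
rewrite OmegaDr !Omega_sumr !big1 ?addr0 // => i _; rewrite ?OmegaDr !OmegaZr.
  by rewrite hh mulr0.
by have [_ -> _ ->] := hyp i j; rewrite !mulr0 addr0.
Qed.

Lemma qform_symp_comb c : q_vanishes A ->
  qform A (symp_comb c) = \sum_i qform A (hyp_part c.1 i).
Proof.
move=> /q_vanishesP q0; have [_ ef ee _ _] := efh.
(* The part along [h] lies in the radical, so it contributes neither to q nor to Omega. *)
have hV : \sum_j c.2 j *: tnth h j \in Vbar0 A.
  by apply: rpred_sum => j _; apply/rpredZ/symp_h_Vbar0.
rewrite qformD // (q0 _ hV) OmegaC (Vbar0P _ _ hV) // !addr0.
apply: qform_sum => [|i j ij]; first exact: index_enum_uniq.
rewrite OmegaDl !OmegaDr !(OmegaZl, OmegaZr).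
rewrite (ef i j).1 (ef j i).2 (ee i j).1 (ee i j).2 [j == i]eq_sym (negPf ij).
by rewrite !mulr0 !addr0.
Qed.

(** The four values of q on the plane are 0, q(f), q(e) and q(e) + q(f) + 1; three of the signs
    agree unless q(e) = q(f) = 1, when three are -1. *)
Lemma sum_chi_hyp i :
  \sum_(a : 'F_2 * 'F_2) chi (qform A (a.1 *: tnth e i + a.2 *: tnth f i)) =
  2 * chi (qform A (tnth e i) * qform A (tnth f i)).
Proof.
have [_ ef _ _ _] := efh.
rewrite -(pair_bigA _ (fun a b => chi (qform A (a *: tnth e i + b *: tnth f i)))) /=.
rewrite sum_F2 !sum_F2 !qformD // !qformZ !(OmegaZl, OmegaZr) (ef i i).1 eqxx.
have [->|->] := F2_cases (qform A (tnth e i));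
  have [->|->] := F2_cases (qform A (tnth f i)); by vm_compute.
Qed.

Lemma chi_sum I (r : seq I) (F : I -> 'F_2) :
  chi (\sum_(i <- r) F i) = \prod_(i <- r) chi (F i).
Proof. exact: (big_morph chi chiD). Qed.

(** The [l] radical coordinates only contribute the factor 2^l. The remaining sum of products over
    the pairs is the product of [k] plane sums, each equal to 2 up to sign. *)
Lemma gauss_symp : q_vanishes A ->
  gauss A = 2 ^+ (k + l) * chi (\sum_i qform A (tnth e i) * qform A (tnth f i)).
Proof.
move=> q0; rewrite /gauss (reindex symp_comb) /=; last exact/onW_bij/symp_comb_bij.
under eq_bigr => c _ do rewrite qform_symp_comb // chi_sum.
rewrite -(pair_bigA _ (fun c (d : {ffun 'I_l -> 'F_2}) =>
  \prod_i chi (qform A (hyp_part c i)))) /=.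
under eq_bigr => c _ do rewrite sumr_const card_ffun card_Fp // card_ord.
rewrite sumrMnl /hyp_part.
rewrite -(bigA_distr_bigA (fun i (a : 'F_2 * 'F_2) =>
  chi (qform A (a.1 *: tnth e i + a.2 *: tnth f i)))).
under eq_bigr => i _ do rewrite sum_chi_hyp.
rewrite big_split /= prodr_const card_ord chi_sum -[LHS]mulr_natr natrX exprD.
by rewrite mulrAC.
Qed.

End SymplecticBasis.
End OmegaBilinear.

Lemma chi_gt0 a : (0 < chi a) = (a == 0).
Proof. by rewrite /chi; case: eqP. Qed.

(** * Existence of symplectic bases *)

Definition has_symplectic_basis n (A : 'M[int]_n) : Prop :=
  exists k l (e f : k.-tuple (Vbar n)) (h : l.-tuple (Vbar n)),
    symplectic_basis A e f h.

Lemma span_mulmx m n (U : 'M['F_2]_(n, m)) (X : seq (Vbar m)) x :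
  x \in <<X>>%VS -> U *m x \in <<map (mulmx U) X>>%VS.
Proof.
move=> xX; have := memv_img (linfun (mulmx U)) xX.
rewrite limg_span lfunE /=; congr (_ \in <<_>>%VS).
by apply: eq_map => y; rewrite lfunE.
Qed.

(** Reduction modulo 2 of the change of basis is an isometry; the image family spans and has the
    right number of elements. *)
Lemma symplectic_eqv L M : L ≃ M -> has_symplectic_basis M -> has_symplectic_basis L.
Proof.
move=> LM [k [l [e [f [h efh]]]]]; have [P [Q [E [PQ QP PE]]]] := LM.
have phiO := Omega_iso (gramP L) (gramP M) (@redmulD _ _ P) (redmul_q PE).
have [b ef ee eh hh] := efh.
exists k, l, (map_tuple (redmul P) e), (map_tuple (redmul P) f), (map_tuple (redmul P) h).
split; try by move=> i j; rewrite !tnth_map !phiO.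
rewrite basisEdim -!map_cat; apply/andP; split; last first.
  rewrite size_map !size_cat !size_tuple dimvf /dim /= muln1 (eqv_rank LM).
  by rewrite (symp_size efh) addnA addnn.
apply/subvP => x _; have [psi _ psiK] := redmul_bij PQ QP.
rewrite -[x]psiK; apply: span_mulmx.
by have /andP[/eqP -> _] := b; rewrite memvf.
Qed.

(** [U] and [W] embed the two summands orthogonally. The concatenated families span, and their total
    length is the rank. *)
Lemma symplectic_osum (L M : lat) :
  has_symplectic_basis L -> has_symplectic_basis M -> has_symplectic_basis (L ⊕ M).
Proof.
move=> [k [l [e [f [h efh]]]]] [k' [l' [e' [f' [h' efh']]]]].
set m := rank_lat L in e f h efh; set n := rank_lat M in e' f' h' efh'.
pose U : 'M['F_2]_(m + n, m) := col_mx 1%:M 0.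
pose W : 'M['F_2]_(m + n, n) := col_mx 0 1%:M.
have Ux x : U *m x = col_mx x 0 by rewrite mul_col_mx mul1mx mul0mx.
have Wx x : W *m x = col_mx 0 x by rewrite mul_col_mx mul1mx mul0mx.
have O0 := Omega0; have OC (N : lat) := OmegaC (gramP N).
have OUU x y : Omega (L ⊕ M) (U *m x) (U *m y) = Omega L x y.
  by rewrite !Ux Omega_block !col_mxKu !col_mxKd O0 ?addr0 //; apply: gramP.
have OWW x y : Omega (L ⊕ M) (W *m x) (W *m y) = Omega M x y.
  by rewrite !Wx Omega_block !col_mxKu !col_mxKd O0 ?add0r //; apply: gramP.
have OUW x y : Omega (L ⊕ M) (U *m x) (W *m y) = 0.
  rewrite Ux Wx Omega_block !col_mxKu !col_mxKd OC !O0 ?addr0 //; exact: gramP.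
have OWU x y : Omega (L ⊕ M) (W *m x) (U *m y) = 0 by rewrite OC OUW.
have [b ef ee eh hh] := efh; have [b' ef' ee' eh' hh'] := efh'.
exists (k + k')%N, (l + l')%N.
exists [tuple of map_tuple (mulmx U) e ++ map_tuple (mulmx W) e'].
exists [tuple of map_tuple (mulmx U) f ++ map_tuple (mulmx W) f'].
exists [tuple of map_tuple (mulmx U) h ++ map_tuple (mulmx W) h'].
split; last 4 first.
- move=> i j; case: (split_ordP i) => i' ->; case: (split_ordP j) => j' ->;
  by rewrite !(tnth_lshift, tnth_rshift) !tnth_map ?OUU ?OWW ?OUW ?OWU ?eq_shift.
- move=> i j; case: (split_ordP i) => i' ->; case: (split_ordP j) => j' ->;
  by rewrite !(tnth_lshift, tnth_rshift) !tnth_map ?OUU ?OWW ?OUW ?OWU.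
- move=> i j; case: (split_ordP i) => i' ->; case: (split_ordP j) => j' ->;
  by rewrite !(tnth_lshift, tnth_rshift) !tnth_map ?OUU ?OWW ?OUW ?OWU.
- move=> i j; case: (split_ordP i) => i' ->; case: (split_ordP j) => j' ->;
  by rewrite !(tnth_lshift, tnth_rshift) !tnth_map ?OUU ?OWW ?OUW ?OWU.
rewrite basisEdim; apply/andP; split; last first.
  rewrite !size_cat !size_tuple dimvf /dim /= muln1 -/m -/n.
  by rewrite (symp_size efh) (symp_size efh') -!addnn; lia.
apply/subvP => x _.
have -> : x = U *m usubmx x + W *m dsubmx x.
  by rewrite Ux Wx add_col_mx addr0 add0r vsubmxK.
have /andP[/eqP s _] := b; have /andP[/eqP s' _] := b'.
apply: rpredD.
  have : U *m usubmx x \in <<map (mulmx U) (e ++ f ++ h)>>%VS.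
    by apply: span_mulmx; rewrite s memvf.
  apply: subvP; apply: sub_span => y; rewrite !map_cat !mem_cat /=.
  by do ?[case/orP]; move=> ->; rewrite ?orbT.
have : W *m dsubmx x \in <<map (mulmx W) (e' ++ f' ++ h')>>%VS.
  by apply: span_mulmx; rewrite s' memvf.
apply: subvP; apply: sub_span => y; rewrite !map_cat !mem_cat /=.
by do ?[case/orP]; move=> ->; rewrite ?orbT.
Qed.

(** Omega is zero, so any basis serves, with no hyperbolic pairs. *)
Lemma symplectic_even n (A : 'M[int]_n) :
  (forall i j, (2 %| A i j)%Z) -> has_symplectic_basis A.
Proof.
move=> hA; exists 0%N, _, [tuple], [tuple], (vbasis fullv).
split; try by case.
  exact: vbasisP.
by move=> i j; apply: Vbar0P; apply: Vbar0_even.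
Qed.

Lemma symplectic_mx2 a b c : ~~ (2 %| b)%Z ->
  has_symplectic_basis (mx2 (2 * a) b b (2 * c)).
Proof.
move=> ob; set A := mx2 _ _ _ _; pose e := col2 1 0; pose f := col2 0 1.
have bE : b%:~R = 1 :> 'F_2.
  by have [/eqP|//] := F2_cases b%:~R; rewrite intrF2_eq0 (negPf ob).
have OE x y : Omega A x y = x 0 0 * y 1 0 + x 1 0 * y 0 0.
  rewrite /Omega bform_mx2 -!liftZ_intr.
  have even2 (u v z : int) : (u * (2 * v) * z)%:~R = 0 :> 'F_2.
    by apply: intrF2_even; rewrite mulrCA -mulrA dvdz_mulr.
  by rewrite 3!rmorphD /= !even2 add0r addr0 !rmorphM /= bE !mulr1.
exists 1%N, 0%N, [tuple e], [tuple f], [tuple]; split; try by move=> ? [].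
- rewrite basisEdim; apply/andP; split; last by rewrite dimvf.
  apply/subvP => x _; have -> : x = x 0 0 *: e + x 1 0 *: f.
    rewrite [LHS]col2E; apply/colP => i; rewrite !mxE.
    by case: (i == 0); rewrite !(mulr0, mulr1, addr0, add0r).
  by apply: rpredD; apply: rpredZ; apply: memv_span; rewrite !inE eqxx ?orbT.
- by move=> i j; rewrite !ord1 !tnth0 !OE !mxE /=; split; apply: val_inj.
- by move=> i j; rewrite !ord1 !tnth0 !OE !mxE /=; split; apply: val_inj.
Qed.

Lemma symplectic_copies k B (eB : even_sym B) :
  has_symplectic_basis B -> has_symplectic_basis (copies_lat k eB).
Proof.
move=> sB; elim: k => [|k IHk]; last first.
  by apply: (symplectic_eqv (copies_latS _ _)); apply: symplectic_osum.
have r0 : rank_lat (copies_lat 0 eB) = 0%N by rewrite /= big_ord0.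
by apply: symplectic_even => i; exfalso; have := ltn_ord i; rewrite {2}r0.
Qed.

(** Read off the normal form: each block has an evident symplectic basis, and these pass to
    orthogonal sums and along congruences. Existence ensures that [Arf] is not the default value. *)
Lemma symplectic_exists (L : lat) : has_symplectic_basis L.
Proof.
have [d Ld] := eqv_nf_lat L; apply: (symplectic_eqv Ld).
do 3 (apply: symplectic_osum; first by
  apply: symplectic_copies; by [apply: symplectic_mx2 | apply/symplectic_even/even_lK]).
apply: symplectic_osum; apply: symplectic_even; [exact: even_scalar2 | exact: even_zero].
Qed.

(** * The parameters of a normal form as invariants *)

Lemma qVbar0_eq0 n (A : 'M[int]_n) : qVbar0 A = [set 0]%SET <-> q_vanishes A.
Proof.
split=> [q0|/q_vanishesP q0].
  apply/q_vanishesP => x xV; apply/set1P; rewrite -q0; exact: imset_f.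
apply/setP=> a; rewrite inE; apply/imsetP/eqP => [[x /q0 -> //]|->].
by exists 0; rewrite ?mem0v ?qform0.
Qed.

Lemma qVbar0_full n (A : 'M[int]_n) : qVbar0 A = [set: 'F_2]%SET -> ~~ q_vanishes A.
Proof.
move=> qT; apply/negP => /qVbar0_eq0; rewrite qT => /setP/(_ 1).
by rewrite !inE oner_eq0.
Qed.

Lemma nf_dimE d :
  nf_dim d = ((nf_r d + nf_s d + nf_t d).*2 + nf_p d + nf_m d)%N.
Proof. by rewrite /nf_dim !sum_nat_const !card_ord; lia. Qed.

Lemma natr_F2_eq0 r : (r%:R == 0 :> 'F_2) = ~~ odd r.
Proof. by rewrite -(dvdn_pcharf (pchar_Fp (isT : prime 2))) dvdn2. Qed.

Lemma F2_eqP (a b : 'F_2) : (a == 0) = (b == 0) -> a = b.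
Proof. by have [->|->] := F2_cases a; have [->|->] := F2_cases b. Qed.

Lemma dim_sum n (V : {vspace Vbar n}) b :
  \sum_x (x \in V)%:R = 2 ^+ b :> int -> \dim V = b.
Proof.
by rewrite card_Vbar_sum -natrX => /eqP; rewrite eqr_nat eqn_exp2l // => /eqP.
Qed.

Section NormalFormInvariants.
Variables (n : nat) (A : 'M[int]_n) (d : nfparams).
Hypotheses (eA : even_sym A) (Ad : normal_form A d).

Let Ld : Lat eA ≃ nf_lat d. Proof. exact: normal_form_eqv. Qed.

Lemma nf_rank : n = ((nf_r d + nf_s d + nf_t d).*2 + nf_p d + nf_m d)%N.
Proof. by rewrite -nf_dimE; have [] := Ad. Qed.

Lemma nf_Vbar0 : \dim (Vbar0 A) = ((nf_t d).*2 + nf_p d + nf_m d)%N.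
Proof.
by apply: dim_sum; rewrite -count0_nf -(count0_eqv Ld).
Qed.

Lemma nf_Vbar000 : \dim (Vbar000 A) = nf_m d.
Proof.
by apply: dim_sum; rewrite -count000_nf -(count000_eqv Ld).
Qed.

Lemma nf_vanishes : q_vanishes A = (nf_p d == 0%N).
Proof. by rewrite -q_vanishes_nf -(q_vanishes_eqv Ld). Qed.

Lemma nf_gauss : q_vanishes A -> (0 < gauss A) = ~~ odd (nf_r d).
Proof.
by rewrite nf_vanishes => /eqP p0; rewrite -gauss_nf_sign // -(gauss_eqv Ld).
Qed.

(** The sign of the Gauss sum is given by the parity of r on the normal form and by the Arf sum in
    every symplectic basis, so the basis behind the choice in [Arf] is immaterial. *)
Lemma nf_Arf : q_vanishes A -> (nf_r d)%:R = Arf A.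
Proof.
move=> q0; have [k [l [e [f [h efh]]]]] := symplectic_exists (Lat eA).
rewrite /Arf; set sympl := fun a : 'F_2 => _.
(* A symplectic basis exists, so [xget] returns a value satisfying the predicate. *)
have : sympl (xget 0 sympl).
  by apply: xgetPex; eexists; exists k, l, e, f, h; split; [exact: efh | reflexivity].
move=> [k' [l' [e' [f' [h' [efh' ->]]]]]].
apply: F2_eqP; rewrite natr_F2_eq0 -nf_gauss // (gauss_symp eA efh' q0).
by rewrite pmulr_rgt0 ?exprn_gt0 // chi_gt0.
Qed.

End NormalFormInvariants.

(** * Comparison of matrices with isometric quadratic forms *)

Section Isometric.
Variables (n : nat) (A A' : 'M[int]_n).
Hypotheses (eA : even_sym A) (eA' : even_sym A').
Hypotheses (dim000 : \dim (Vbar000 A) = \dim (Vbar000 A')).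
Hypothesis iso : qf_iso (qform A) (qform A').

Lemma qf_iso_vanishes : q_vanishes A = q_vanishes A'.
Proof.
have [T Tb Tq] := iso; exact: (q_vanishes_iso eA eA' Tb (linearD T) Tq).
Qed.

Lemma qf_iso_gauss : gauss A = gauss A'.
Proof. have [T Tb Tq] := iso; exact: (gauss_iso Tb Tq). Qed.

Lemma qf_iso_dim : \dim (Vbar0 A) = \dim (Vbar0 A').
Proof.
have [T Tb Tq] := iso; apply: dim_sum.
rewrite -[LHS]/(count0 A) (count0_iso eA eA' Tb (linearD T) Tq) [LHS]card_Vbar_sum.
by rewrite natrX.
Qed.

Variables d d' : nfparams.
Hypotheses (Ad : normal_form A d) (Ad' : normal_form A' d').

Lemma nf_iso_m : nf_m d = nf_m d'.
Proof. by rewrite -(nf_Vbar000 eA Ad) dim000 (nf_Vbar000 eA' Ad'). Qed.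

Lemma nf_iso_tp : ((nf_t d).*2 + nf_p d = (nf_t d').*2 + nf_p d')%N.
Proof.
by have := nf_Vbar0 eA Ad; rewrite qf_iso_dim (nf_Vbar0 eA' Ad') nf_iso_m; lia.
Qed.

Lemma nf_iso_p : (nf_p d = nf_p d' %[mod 2])%N.
Proof. by have := nf_iso_tp; lia. Qed.

Lemma nf_iso_r : q_vanishes A -> (nf_r d = nf_r d' %[mod 2])%N.
Proof.
move=> q0; have := nf_gauss eA Ad q0.
rewrite qf_iso_gauss (nf_gauss eA' Ad') -?qf_iso_vanishes //.
by rewrite !modn2 => /negb_inj ->.
Qed.

(** The invariants fix m and 2t + p, so p determines t; the rank together with r then determines
    s. *)
Lemma nf_iso_eq : nf_p d = nf_p d' -> nf_r d = nf_r d' -> d = d'.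
Proof.
have := nf_iso_m; have := nf_iso_tp; have := nf_rank Ad; have := nf_rank Ad'.
case: d d' => r s t p m [r' s' t' p' m'] /= h1 h2 h3 h4 h5 h6.
by congr NFParams; lia.
Qed.

(** Vanishing of q on the radical decides whether p is 0 or in {1, 2}, and parity then fixes p. In
    the first case r is 0 or 1 and fixed by parity; in the second it is 0. *)
Lemma nf_iso_reduced : reduced d -> reduced d' -> d = d'.
Proof.
move=> rd rd'; have := nf_iso_eq; have := nf_iso_p; have := nf_iso_r.
have := nf_vanishes eA Ad; have := nf_vanishes eA' Ad'.
rewrite -qf_iso_vanishes => -> pd; rewrite pd => hr hp; apply.
  by move: rd rd' pd hp; rewrite /reduced; lia.
by move: rd rd' pd hr; rewrite /reduced; case: eqP; lia.
Qed.

End Isometric.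

(** * Existence of reduced normal forms and the theorem *)

Lemma reduced_exists n (A : 'M[int]_n) : even_sym A ->
  exists2 d, normal_form A d & reduced d.
Proof.
move=> eA; have [d Ld] := eqv_nf_lat (Lat eA); have [d' rd' dd'] := nf_reduced d.
by exists d' => //; apply: (eqv_normal_form (eA := eA)); rewrite Ld dd'.
Qed.

(** Both matrices have the same reduced normal form, so they are congruent to each other modulo 4
    and share all normal forms. *)
Lemma qf_iso_normal_form n (A A' : 'M[int]_n) d : even_sym A -> even_sym A' ->
  \dim (Vbar000 A) = \dim (Vbar000 A') -> qf_iso (qform A) (qform A') ->
  normal_form A d <-> normal_form A' d.
Proof.
move=> eA eA' dim000 iso.
have [d1 Ad1 r1] := reduced_exists eA; have [d1' Ad1' r1'] := reduced_exists eA'.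
have dd := nf_iso_reduced eA eA' dim000 iso Ad1 Ad1' r1 r1'; rewrite -{}dd in Ad1' *.
have AA' : Lat eA ≃ Lat eA'.
  by rewrite (normal_form_eqv eA Ad1) (normal_form_eqv eA' Ad1').
split=> /normal_form_eqv h; apply: eqv_normal_form.
  by rewrite -AA'; apply: h.
by rewrite AA'; apply: h.
Qed.

Lemma qf_iso_refl n (q : Vbar n -> 'F_2) : qf_iso q q.
Proof. by exists idfun => //; exists id. Qed.

Lemma reduced_vanishes n (A : 'M[int]_n) d : even_sym A -> normal_form A d ->
  q_vanishes A -> reduced d = (nf_r d <= 1)%N.
Proof. by move=> eA Ad; rewrite (nf_vanishes eA Ad) /reduced => /eqP ->; rewrite orbF. Qed.

Lemma reduced_nonvanishing n (A : 'M[int]_n) d : even_sym A -> normal_form A d ->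
  ~~ q_vanishes A -> reduced d = (1 <= nf_p d <= 2)%N && (nf_r d == 0%N).
Proof. by move=> eA Ad; rewrite (nf_vanishes eA Ad) /reduced => /negPf ->. Qed.

Theorem theorem1p2 (n : nat) (A : 'M[int]_n)
    (symA : A^T = A) (evenA : forall i, (2 %| A i i)%Z) :
  (* (a) *)
  (forall d : nfparams, normal_form A d ->
     [/\ nf_m d = \dim (Vbar000 A),
         (nf_p d = \dim (Vbar0 A) - \dim (Vbar000 A) %[mod 2])%N
       & qVbar0 A = [set 0] -> (nf_r d)%:R = Arf A])
  /\
  (* (b), general part *)
  (forall A' : 'M[int]_n, A'^T = A' -> (forall i, (2 %| A' i i)%Z) ->
     \dim (Vbar000 A) = \dim (Vbar000 A') -> qf_iso (qform A) (qform A') ->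
     (forall d, normal_form A d <-> normal_form A' d)
     /\ (forall d d', normal_form A d -> normal_form A' d' ->
           [/\ nf_m d = nf_m d',
               (nf_p d = nf_p d' %[mod 2])%N,
               qVbar0 A = [set 0] -> (nf_r d = nf_r d' %[mod 2])%N
             & nf_p d = nf_p d' -> nf_r d = nf_r d' -> d = d']))
  /\
  (* (b), explicit part, q(Vbar_0) = {0} *)
  (qVbar0 A = [set 0] ->
     (exists! d, normal_form A d /\ (nf_r d <= 1)%N)
     /\ (forall A' : 'M[int]_n, A'^T = A' -> (forall i, (2 %| A' i i)%Z) ->
           \dim (Vbar000 A) = \dim (Vbar000 A') ->
           qf_iso (qform A) (qform A') ->
           forall d d', normal_form A d -> (nf_r d <= 1)%N ->
             normal_form A' d' -> (nf_r d' <= 1)%N -> d = d'))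
  /\
  (* (b), explicit part, q(Vbar_0) = F_2 *)
  (qVbar0 A = [set: 'F_2] ->
     (exists! d, normal_form A d /\ ((1 <= nf_p d <= 2)%N /\ nf_r d = 0%N))
     /\ (forall A' : 'M[int]_n, A'^T = A' -> (forall i, (2 %| A' i i)%Z) ->
           \dim (Vbar000 A) = \dim (Vbar000 A') ->
           qf_iso (qform A) (qform A') ->
           forall d d',
             normal_form A d -> (1 <= nf_p d <= 2)%N -> nf_r d = 0%N ->
             normal_form A' d' -> (1 <= nf_p d' <= 2)%N -> nf_r d' = 0%N ->
             d = d')).
Proof.
have eA : even_sym A by [].
split=> [d Ad|].
  split; first by rewrite (nf_Vbar000 eA Ad).
    (* The difference of dimensions is 2t + p. *)
    by rewrite (nf_Vbar000 eA Ad) (nf_Vbar0 eA Ad); lia.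
  by move=> /qVbar0_eq0; apply: nf_Arf.
split=> [A' sA' evA' dim000 iso|].
  have eA' : even_sym A' by [].
  split=> [d|d d' Ad Ad']; first exact: qf_iso_normal_form.
  split.
  - exact: (nf_iso_m eA eA' dim000 Ad Ad').
  - exact: (nf_iso_p eA eA' dim000 iso Ad Ad').
  - by move=> /qVbar0_eq0; apply: (nf_iso_r eA eA' iso Ad Ad').
  - exact: (nf_iso_eq eA eA' dim000 iso Ad Ad').
have [d0 Ad0 r0] := reduced_exists eA.
split=> [/qVbar0_eq0 q0|/qVbar0_full q1].
  split; [exists d0; split=> [|d [Ad rd]]|].
  - by rewrite -(reduced_vanishes eA Ad0).
  (* Uniqueness is the comparison of [A] with itself through the identity isometry. *)
  - by apply: (nf_iso_reduced eA eA) => //;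
      [apply: qf_iso_refl | rewrite (reduced_vanishes eA Ad)].
  move=> A' sA' evA' dim000 iso d d' Ad rd Ad' rd'; have eA' : even_sym A' by [].
  apply: (nf_iso_reduced eA eA') => //; first by rewrite (reduced_vanishes eA Ad).
  by rewrite (reduced_vanishes eA' Ad') // -(qf_iso_vanishes eA eA').
split; [exists d0; split=> [|d [Ad [pd rd]]]|].
- by split=> //; move: r0; rewrite (reduced_nonvanishing eA Ad0) // => /andP[? /eqP].
- apply: (nf_iso_reduced eA eA) => //; first exact: qf_iso_refl.
  by rewrite (reduced_nonvanishing eA Ad) // pd rd.
move=> A' sA' evA' dim000 iso d d' Ad pd rd Ad' pd' rd'; have eA' : even_sym A' by [].
apply: (nf_iso_reduced eA eA') => //.
  by rewrite (reduced_nonvanishing eA Ad) // pd rd.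
by rewrite (reduced_nonvanishing eA' Ad') ?pd' ?rd' // -(qf_iso_vanishes eA eA').
Qed.
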